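(* Let $q\in\mathbb C$ with $q\ne0$, $|q|\neq1$. Let $a_i,b_i$, $i=1,\dots,6$, be the generators of $Q_q(6)$ and let $\mathsf F_{ijk}$, the quantum exponential $\langle\,\cdot\,\rangle$, and the notation $R_{ijk}(\lambda)$ be as in the context. Consider the tetrahedron equation $$R_{123} (\lambda) \, R_{145} (\lambda\mu) \, R_{246} (\nu) \, R_{356}(\mu) = R_{356}(\nu) \, R_{246}(\mu) \, R_{145}(\lambda\nu) \, R_{123}(\lambda). \qquad ( * )$$ (i) Let $\alpha_1,\alpha_2,\alpha_3,\beta_1,\beta_2,\beta_3\in\mathbb Z$ satisfy $$\alpha_1+\alpha_2=0,\qquad \beta_2=0,\qquad \beta_1+\beta_3=0,$$ and $(\alpha_1+\alpha_3)\beta_1\neq0$. Let $Q=q^{-(\alpha_1+\alpha_3)\beta_1}$, let $m$ be a positive integer, $k\in\mathbb Z$, and $$g_{q,\lambda}(t)=\Bigl\langle Q^{\frac{m(m-1)}2}\lambda^k\,t^m\Bigr\rangle_{Q^{m^2}} .$$ Then $$R_{123}(\lambda)=\mathsf F_{123}\; g_{q,\lambda}\bigl(q^{-\alpha_1\beta_1}a_1^{\alpha_1}a_2^{\alpha_2}a_3^{\alpha_3}b_1^{\beta_1}b_2^{\beta_2}b_3^{\beta_3}\bigr)$$ satisfies the tetrahedron equation $( * )$. (ii) Let $\alpha,\beta,\delta,\hat\alpha,\hat\beta,\hat\delta\in\mathbb Z$ satisfy $$\alpha\hat\beta+\hat\delta\beta=0,\qquad \hat\alpha\beta+\delta\hat\beta=0,$$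 and $(\alpha+\delta)\beta\ne0$, $(\hat\alpha+\hat\delta)\hat\beta\neq0$. Let $Q=q^{-(\alpha+\delta)\beta}$, $\widehat Q=q^{-(\hat\alpha+\hat\delta)\hat\beta}$, let $m,\widehat m$ be positive integers, $k,l\in\mathbb Z$, and $$g_{q,\lambda}(t)=\Bigl\langle Q^{\frac{m(m-1)}2}\lambda^k\,t^m\Bigr\rangle_{Q^{m^2}},\qquad f_{q,\lambda}(t)=\Bigl\langle \widehat Q^{\frac{\widehat m(\widehat m-1)}2}\lambda^l\,t^{\widehat m}\Bigr\rangle_{\widehat Q^{\widehat m^2}} .$$ Then $$R_{123}(\lambda)=\mathsf F_{123}\; g_{q,\lambda}\bigl(q^{-\alpha\beta}a_1^{\alpha}a_2^{-\alpha}a_3^{\delta}\,b_1^{\beta}b_3^{-\beta}\bigr)\; f_{q,\lambda}\bigl(q^{-\hat\alpha\hat\beta}a_1^{\hat\alpha}a_2^{-\hat\alpha}a_3^{\hat\delta}\,b_1^{\hat\beta}b_3^{-\hat\beta}\bigr)$$ satisfies the tetrahedron equation $( * )$. In both parts $\lambda,\mu,\nu\in\mathbb C$ are arbitrary (nonzero if a negative power of them occurs).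
   Context: $Q_q(6)$ is the associative unital $\mathbb C$-algebra with generators $a_i^{\pm1},b_i^{\pm1}$, $i=1,\dots,6$, and relations $a_ib_j=q^{\delta_{ij}}b_ja_i$, $a_ia_j=a_ja_i$, $b_ib_j=b_jb_i$, $a_ia_i^{-1}=a_i^{-1}a_i=1$, $b_ib_i^{-1}=b_i^{-1}b_i=1$. For $p\in\mathbb C$ nonzero with $|p|\ne1$, $\langle x\rangle_p=\sum_{n\ge 0}\frac{(-x)^n}{(1-p)(1-p^2)\cdots(1-p^n)}$ is a formal power series in $x$ (the $n=0$ term is $1$). For $1\le i<j<k\le 6$, $\mathcal F_{ijk}$ is the involutive automorphism of $Q_q(6)$ given by $a_i\mapsto a_i$, $a_j\mapsto a_ia_k$, $a_k\mapsto a_i^{-1}a_j$, $b_i\mapsto b_ib_jb_k^{-1}$, $b_j\mapsto b_k$, $b_k\mapsto b_j$, and fixing all $a_l,b_l$ with $l\notin\{i,j,k\}$. These satisfy $\mathcal F_{123}\mathcal F_{145}\mathcal F_{246}\mathcal F_{356}=\mathcal F_{356}\mathcal F_{246}\mathcal F_{145}\mathcal F_{123}$ (composition). Let $G$ be the group of automorphisms of $Q_q(6)$ generated by all $\mathcal F_{ijk}$, and let $\mathsf F_{ijk}$ denote the element $\mathcal F_{ijk}$ of $G$ viewed in the skew group algebra of $G$ over $Q_q(6)$; thus $\mathsf F_{ijk}^2=1$, $\mathsf F_{ijk}\,x=\mathcal F_{ijk}(x)\,\mathsf F_{ijk}$ for $x\in Q_q(6)$, and the $\mathsf F$'s multiply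 as the automorphisms do. $R_{ijk}(\lambda)$ is obtained from $R_{123}(\lambda)$ by substituting the labels $1\to i$, $2\to j$, $3\to k$ in $\mathsf F$, the $a$'s and the $b$'s. Formal conventions: one works with formal (possibly infinite) $\mathbb C$-linear combinations of elements $gM$, $g\in G$, $M$ in the monomial basis $\prod a_i^{m_i}\prod b_i^{n_i}$ of $Q_q(6)$; products are computed termwise whenever each basis element receives finitely many contributions, which is the case for all products appearing in the claim. *)

(* Defs.v *)
From HB Require Import structures.
From mathcomp Require Import all_boot all_order all_algebra.
From mathcomp Require Import finmap.
From mathcomp Require Import multinomials.monalg.
From mathcomp Require Import boolp classical_sets functions cardinality fsbigop reals.

Set Implicit Arguments.
Unset Strict Implicit.
Unset Printing Implicit Defensive.

Import Order.TTheory GRing.Theory Num.Theory.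

Local Open Scope ring_scope.
Local Open Scope classical_set_scope.

(** (m, n) : mon stands for a_1^m_1 ... a_6^m_6 b_1^n_1 ... b_6^n_6; the label
    i in {1..6} is the ordinal i - 1. *)
Definition mon : Type := ({ffun 'I_6 -> int} * {ffun 'I_6 -> int})%type.
HB.instance Definition _ := GRing.Zmodule.on mon.

Definition pairing (M N : mon) : int := \sum_i M.2 i * N.1 i.

(** Q_q(6), realized on its monomial basis: b_i a_i = q^-1 a_i b_i gives
    (a^m b^n) (a^m' b^n') = q^(- n.m') a^(m+m') b^(n+n').
    [qsubst_morph] and [qtorus_hom_ext] show that it is the algebra presented
    by the generators and relations of [qrel]. *)
Definition qtorus (C : fieldType) (q : C) (hq : q != 0) : Type := {malg C[mon]}.

Section Algebra.
Context (C : fieldType) (q : C) (hq : q != 0).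
Local Notation Q := (qtorus hq).

HB.instance Definition _ := GRing.Lmodule.on Q.

Implicit Types (x y z : Q) (M N : mon).

Definition mono M : Q := << M >>.

Definition qone : Q := mono 0.

Definition qmul : Q -> Q -> Q := locked (fun x y =>
  \sum_(M <- msupp x) \sum_(N <- msupp y)
    << x@_M * y@_N * q ^ (- pairing M N) *g M + N >>).

Lemma pairingDl M M' N : pairing (M + M') N = pairing M N + pairing M' N.
Proof.
by rewrite -big_split /=; apply: eq_bigr => i _; rewrite ffunE mulrDl.
Qed.

Lemma pairingDr M N N' : pairing M (N + N') = pairing M N + pairing M N'.
Proof.
by rewrite -big_split /=; apply: eq_bigr => i _; rewrite ffunE mulrDr.
Qed.

Lemma pairing0l M : pairing 0 M = 0.
Proof. by apply: big1 => i _; rewrite ffunE mul0r. Qed.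

Lemma pairing0r M : pairing M 0 = 0.
Proof. by apply: big1 => i _; rewrite ffunE mulr0. Qed.

Lemma qmulw (d1 d2 : {fset mon}) x y :
  (msupp x `<=` d1 -> msupp y `<=` d2 ->
  qmul x y = \sum_(M <- d1) \sum_(N <- d2)
    << x@_M * y@_N * q ^ (- pairing M N) *g M + N >>)%fset.
Proof.
move=> le1 le2; rewrite /qmul -lock (big_fset_incl _ le1) /=.
  apply: eq_bigr => M _; apply: big_fset_incl => // N _ /mcoeff_outdom ->.
  by rewrite mulr0 mul0r monalgU0.
move=> M _ /mcoeff_outdom xM.
by rewrite big1 // => N _; rewrite xM !mul0r monalgU0.
Qed.

Lemma qmulDl : left_distributive qmul +%R.
Proof.
move=> x y z; rewrite [in RHS](qmulw (fsubsetUl _ (msupp y)) (fsubset_refl _)).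
rewrite [in RHS](qmulw (fsubsetUr (msupp x) _) (fsubset_refl _)).
rewrite (qmulw (msuppD_le _ _) (fsubset_refl _)) -big_split /=.
apply: eq_bigr => M _; rewrite -big_split /=; apply: eq_bigr => N _.
by rewrite mcoeffD !mulrDl monalgUD.
Qed.

Lemma qmulDr : right_distributive qmul +%R.
Proof.
move=> x y z; rewrite [in RHS](qmulw (fsubset_refl _) (fsubsetUl _ (msupp z))).
rewrite [in RHS](qmulw (fsubset_refl _) (fsubsetUr (msupp y) _)).
rewrite (qmulw (fsubset_refl _) (msuppD_le _ _)) -big_split /=.
apply: eq_bigr => M _; rewrite -big_split /=; apply: eq_bigr => N _.
by rewrite mcoeffD mulrDr mulrDl monalgUD.
Qed.

Lemma qmul0 : left_zero 0 qmul.
Proof. by move=> x; rewrite /qmul -lock msupp0 big_seq_fset0. Qed.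

Lemma qmulx0 : right_zero 0 qmul.
Proof.
by move=> x; rewrite /qmul -lock big1 // => M _; rewrite msupp0 big_seq_fset0.
Qed.

Lemma qmulUU c d M N :
  qmul << c *g M >> << d *g N >> = << c * d * q ^ (- pairing M N) *g M + N >>.
Proof. by rewrite (qmulw msuppU_le msuppU_le) !big_seq_fset1 !mcoeffUU. Qed.

Lemma qmulA : associative qmul.
Proof.
move: qmulDl qmulDr qmul0 qmulx0 qmulUU.
move: qmul => m mDl mDr m0 mx0 mUU x y z.
rewrite [x]monalgE [y]monalgE [z]monalgE.
have suml (I : Type) (r : seq I) (F : I -> Q) w :
    m (\sum_(i <- r) F i) w = \sum_(i <- r) m (F i) w.
  by apply: (big_morph (m^~ w) (fun _ _ => mDl _ _ _) (m0 _)).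
have sumr (I : Type) (r : seq I) (F : I -> Q) w :
    m w (\sum_(i <- r) F i) = \sum_(i <- r) m w (F i).
  by apply: (big_morph (m w) (fun _ _ => mDr _ _ _) (mx0 _)).
rewrite !suml; apply: eq_bigr => M _.
rewrite (sumr _ (msupp y)) (sumr _ (msupp y)) suml; apply: eq_bigr => N _.
rewrite !(suml, sumr); apply: eq_bigr => P _.
rewrite [in LHS](mUU _ _ N P) [LHS]mUU [in RHS](mUU _ _ M N) [RHS]mUU.
rewrite pairingDl pairingDr (addrA M N P); congr << _ *g _ >>.
rewrite !opprD !expfzDr // -!mulrA; congr (_ * (_ * _)).
by rewrite [RHS]mulrCA; congr (_ * _); rewrite mulrC -mulrA.
Qed.

Lemma qmul1x : left_id qone qmul.
Proof.
move=> x; rewrite (qmulw msuppU_le (fsubset_refl _)) big_seq_fset1 [RHS]monalgE.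
by apply: eq_bigr => M _; rewrite mcoeffUU pairing0l oppr0 mulr1 mul1r add0r.
Qed.

Lemma qmulx1 : right_id qone qmul.
Proof.
move=> x; rewrite (qmulw (fsubset_refl _) msuppU_le) [RHS]monalgE.
apply: eq_bigr => M _.
by rewrite big_seq_fset1 mcoeffUU pairing0r oppr0 !mulr1 addr0.
Qed.

Lemma qone_neq0 : qone != 0.
Proof. by rewrite /qone /mono monalgU_eq0 oner_eq0. Qed.

HB.instance Definition _ := GRing.Zmodule_isNzRing.Build Q
  qmulA qmul1x qmulx1 qmulDl qmulDr qone_neq0.

Lemma qscaleU c d M : c *: (<< d *g M >> : Q) = << c * d *g M >>.
Proof. by apply/malgP => N; rewrite mcoeffZ !mcoeffU -mulrnAr. Qed.

Lemma qscaleAl c x y : c *: (x * y) = (c *: x) * y.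
Proof.
rewrite [RHS](qmulw (msuppZ_le _ _) (fsubset_refl _)).
rewrite (qmulw (fsubset_refl _) (fsubset_refl _) : x * y = _) scaler_sumr.
apply: eq_bigr => M _; rewrite scaler_sumr; apply: eq_bigr => N _.
by rewrite qscaleU mcoeffZ !mulrA.
Qed.

Lemma qscaleAr c x y : c *: (x * y) = x * (c *: y).
Proof.
rewrite [RHS](qmulw (fsubset_refl _) (msuppZ_le _ _)).
rewrite (qmulw (fsubset_refl _) (fsubset_refl _) : x * y = _) scaler_sumr.
apply: eq_bigr => M _; rewrite scaler_sumr; apply: eq_bigr => N _.
by rewrite qscaleU mcoeffZ mulrA; congr << _ * _ *g _ >>; rewrite mulrCA.
Qed.

HB.instance Definition _ := GRing.Lmodule_isLalgebra.Build C Q qscaleAl.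
HB.instance Definition _ := GRing.Lalgebra_isAlgebra.Build C Q qscaleAr.

Definition qunit : pred Q := fun x => `[< exists y, y * x = 1 /\ x * y = 1 >].

Definition qinv x : Q :=
  if pselect (exists y, y * x = 1 /\ x * y = 1) is left h then projT1 (cid h)
  else x.

Lemma qinvP x : x \in qunit -> qinv x * x = 1 /\ x * qinv x = 1.
Proof.
by move=> /asboolP h; rewrite /qinv; case: pselect => // h'; case: cid.
Qed.

Lemma qmulVx : {in qunit, left_inverse 1 qinv *%R}.
Proof. by move=> x /qinvP[]. Qed.

Lemma qmulxV : {in qunit, right_inverse 1 qinv *%R}.
Proof. by move=> x /qinvP[]. Qed.

Lemma qunitP x y : y * x = 1 /\ x * y = 1 -> qunit x.
Proof. by move=> h; apply/asboolP; exists y. Qed.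

Lemma qinv_out : {in [predC qunit], qinv =1 id}.
Proof. by move=> x /asboolP h; rewrite /qinv; case: pselect. Qed.

HB.instance Definition _ := GRing.NzRing_hasMulInverse.Build Q
  qmulVx qmulxV qunitP qinv_out.

End Algebra.

Section Presentation.
Context (C : fieldType) (q : C) (hq : q != 0).
Local Notation Q := (qtorus hq).

Definition agen (i : 'I_6) : Q := mono hq ([ffun j => (j == i)%:R], 0).
Definition bgen (i : 'I_6) : Q := mono hq (0, [ffun j => (j == i)%:R]).

Definition qrel (B : unitAlgType C) (a b : 'I_6 -> B) : Prop :=
  [/\ forall i, a i \is a GRing.unit /\ b i \is a GRing.unit,
      forall i j, a i * a j = a j * a i,
      forall i j, b i * b j = b j * b i &
      forall i j, a i * b j = q ^+ (i == j) *: (b j * a i)].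

(** The algebra morphism sending a_i to [a i] and b_i to [b i], see
    [qsubst_morph]. *)
Definition qsubst (B : unitAlgType C) (a b : 'I_6 -> B) (x : Q) : B :=
  \sum_(M <- msupp x)
    x@_M *: (\prod_i a i ^ M.1 i * \prod_i b i ^ M.2 i).

Lemma monoM M N : mono hq M * mono hq N = q ^ (- pairing M N) *: mono hq (M + N).
Proof. by rewrite [LHS]qmulUU qscaleU !mulr1 mul1r. Qed.

Lemma mono0 : mono hq 0 = 1. Proof. by []. Qed.

Lemma mono_unit M : mono hq M \is a GRing.unit.
Proof.
apply/unitrP; exists (q ^ (- pairing M M) *: mono hq (- M)).
rewrite -scalerAl -scalerAr !monoM subrr addNr mono0 !scalerA -!expfzDr //.
suff [-> ->] : pairing (- M) M = - pairing M M /\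
               pairing M (- M) = - pairing M M by rewrite opprK addNr scale1r.
split; apply/eqP; rewrite -addr_eq0 -?pairingDl -?pairingDr addNr.
  by rewrite pairing0l.
by rewrite pairing0r.
Qed.

Lemma monoE (x : Q) : x = \sum_(M <- msupp x) x@_M *: mono hq M.
Proof.
by rewrite [LHS]monalgE; apply: eq_bigr => M _; rewrite qscaleU mulr1.
Qed.

Lemma linear_mono_morph (B : unitAlgType C) (f : {linear Q -> B}) :
  (forall M N, f (mono hq M * mono hq N) = f (mono hq M) * f (mono hq N)) ->
  {morph f : x y / x * y}.
Proof.
move=> fM x y; rewrite [x]monoE [y]monoE mulr_suml !linear_sum /= mulr_suml.
apply: eq_bigr => M _; rewrite mulr_sumr linear_sum mulr_sumr /=.
apply: eq_bigr => N _.
have lin c u : f (c *: u) = c *: f u by exact: linearZZ.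
rewrite -scalerAl -scalerAr lin lin fM.
apply/esym/(etrans (congr2 *%R (lin _ _) (lin _ _))).
by rewrite -scalerAl -scalerAr.
Qed.

Section Univ.
Context (B : unitAlgType C) (a b : 'I_6 -> B) (hab : qrel a b).

Let psi (M : mon) := \prod_i a i ^ M.1 i * \prod_i b i ^ M.2 i.

Let scomm (c : C) (x y : B) := y * x = c *: (x * y).

Let scomm1 x : scomm 1 x 1.
Proof. by rewrite /scomm mul1r mulr1 scale1r. Qed.

Let scommM c d x y z : scomm c x y -> scomm d x z -> scomm (c * d) x (y * z).
Proof.
rewrite /scomm => hy hz.
by rewrite -mulrA hz -scalerAr (mulrA y) hy -scalerAl scalerA -mulrA (mulrC d).
Qed.

Let scommX c x y (n : int) : c != 0 -> y \is a GRing.unit ->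
  scomm c x y -> scomm (c ^ n) x (y ^ n).
Proof.
move=> c0 uy h.
have hn (d : C) (z : B) (k : nat) : scomm d x z -> scomm (d ^+ k) x (z ^+ k).
  move=> hd; elim: k => [|k IH]; first exact: scomm1.
  by rewrite !exprS; apply: scommM.
case: n => n; first exact: hn.
rewrite NegzE -!exprnN -!exprVn; apply: hn; rewrite /scomm.
apply: (mulrI uy); apply: (mulIr uy).
rewrite mulrA divrr // mul1r -scalerAr -scalerAl !mulrA h -!scalerAl.
by rewrite scalerA mulVf // scale1r divrK.
Qed.

Let scomm_sym c x y : c != 0 -> scomm c x y -> scomm c^-1 y x.
Proof. by rewrite /scomm => c0 ->; rewrite scalerA mulVf // scale1r. Qed.

Let scomm_prod c x (y : 'I_6 -> B) :
  (forall j, scomm (c j) x (y j)) -> scomm (\prod_j c j) x (\prod_j y j).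
Proof.
move=> h; apply: (big_ind2 (fun d z => scomm d x z)) => //.
by move=> c1 y1 c2 y2; apply: scommM.
Qed.

Let scommXX c x y (m n : int) : c != 0 ->
  x \is a GRing.unit -> y \is a GRing.unit ->
  scomm c x y -> scomm (c ^ (n * m)) (x ^ m) (y ^ n).
Proof.
move=> c0 ux uy h; have cn0 : c ^ n != 0 by rewrite expfz_neq0.
have := scommX m _ ux (scomm_sym cn0 (scommX n c0 uy h)).
rewrite invr_eq0 => /(_ cn0) /scomm_sym; rewrite expfz_neq0 ?invr_eq0 //.
by move=> /(_ isT); rewrite exprz_inv invr_expz opprK exprz_exp.
Qed.

Let scomm_prod2 (c : 'I_6 -> 'I_6 -> C) (x y : 'I_6 -> B) :
  (forall i j, c i j != 0) -> (forall i j, scomm (c i j) (x i) (y j)) ->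
  scomm (\prod_j \prod_i c i j) (\prod_i x i) (\prod_j y j).
Proof.
move=> c0 h; apply: scomm_prod => j.
rewrite -[X in scomm X]invrK; apply: scomm_sym.
  by rewrite invr_eq0; apply/prodf_neq0.
by rewrite -prodfV; apply: scomm_prod => i; apply: scomm_sym.
Qed.

Lemma prod_genX_add (e : 'I_6 -> B) (m n : {ffun 'I_6 -> int}) :
  (forall i, e i \is a GRing.unit) -> (forall i j, e i * e j = e j * e i) ->
  \prod_i e i ^ m i * \prod_i e i ^ n i = \prod_i e i ^ (m + n) i.
Proof.
move=> ue ce; rewrite -prodrM_comm.
  by apply: eq_bigr => i _; rewrite ffunE exprzDr.
by move=> i j _ _; apply: commrXz; apply/commr_sym/commrXz/ce.
Qed.

Lemma qsubst_mono_mul (M N : mon) :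
  psi M * psi N = q ^ (- pairing M N) *: psi (M + N).
Proof.
have [u ca cb cab] := hab.
rewrite /psi -prod_genX_add //; last by move=> i; case: (u i).
rewrite -prod_genX_add //; last by move=> i; case: (u i).
rewrite -!mulrA [in LHS](mulrA (\prod_i b i ^ M.2 i)).
suff -> : \prod_i b i ^ M.2 i * \prod_i a i ^ N.1 i =
    q ^ (- pairing M N) *: (\prod_i a i ^ N.1 i * \prod_i b i ^ M.2 i).
  by rewrite -scalerAl -scalerAr -!mulrA.
have -> : q ^ (- pairing M N) =
    \prod_j \prod_i ((q^-1) ^+ (i == j)) ^ (M.2 j * N.1 i).
  rewrite /pairing -sumrN (big_morph _ (fun x y => expfzDr x y hq) (expr0z q)).
  apply: eq_bigr => j _; rewrite (bigD1 j) //= eqxx big1 ?mulr1 => [|i /negPf->].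
    by rewrite expr1 exprz_inv.
  by rewrite expr0 exp1rz.
have q10 (d : bool) : q^-1 ^+ d != 0 by rewrite expf_neq0 // invr_eq0.
apply: (scomm_prod2 (x := fun i => a i ^ N.1 i)) => i j.
  by rewrite expfz_neq0.
apply: scommXX => //; [by case: (u i)|by case: (u j)|].
rewrite exprVn; apply: scomm_sym; first by rewrite expf_neq0.
exact: cab.
Qed.

Lemma qsubst_is_linear : linear (qsubst a b).
Proof.
have qsubstw (d : {fset mon}) x : (msupp x `<=` d)%fset ->
    qsubst a b x = \sum_(M <- d) x@_M *: psi M.
  move=> le; apply: big_fset_incl => // M _ /mcoeff_outdom ->.
  by rewrite scale0r.
move=> c x y; pose d := (msupp (c *: x + y) `|` (msupp x `|` msupp y))%fset.
rewrite !(qsubstw d) ?fsubsetUl //; first last.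
- by rewrite /d fsetUCA fsubsetUl.
- by rewrite /d fsetUA fsubsetUr.
rewrite scaler_sumr -big_split /=; apply: eq_bigr => M _.
by rewrite mcoeffD mcoeffZ scalerDl scalerA.
Qed.

Let qsubst_linear : {linear Q -> B} := HB.pack (qsubst a b)
  (GRing.isLinear.Build C Q B *:%R (qsubst a b) qsubst_is_linear).

Lemma qsubst_mono M : qsubst a b (mono hq M) = psi M.
Proof. by rewrite /qsubst msuppU oner_eq0 big_seq_fset1 mcoeffUU scale1r. Qed.

Lemma qsubst_is_monoid_morphism : monoid_morphism (qsubst a b).
Proof.
split.
  rewrite -mono0 qsubst_mono /psi !big1 ?mulr1 // => i _;
  by rewrite ffunE expr0z.
apply: (linear_mono_morph (f := qsubst_linear)) => M N.
by rewrite monoM linearZ /= !qsubst_mono qsubst_mono_mul.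
Qed.

Lemma qsubst_morph :
  linear (qsubst a b) /\ monoid_morphism (qsubst a b) /\
  forall i, qsubst a b (agen i) = a i /\ qsubst a b (bgen i) = b i.
Proof.
split; [exact: qsubst_is_linear|split; first exact: qsubst_is_monoid_morphism].
have delta (e : 'I_6 -> B) i :
    \prod_j e j ^ ([ffun k => (k == i)%:R] : {ffun 'I_6 -> int}) j = e i.
  transitivity (\prod_(j | j == i) e j); last exact: big_pred1_eq.
  by rewrite [RHS]big_mkcond; apply: eq_bigr => j _; rewrite ffunE; case: eqP.
have one (e : 'I_6 -> B) : \prod_j e j ^ (0 : {ffun 'I_6 -> int}) j = 1.
  by rewrite big1 // => i _; rewrite ffunE expr0z.
by move=> i; rewrite !qsubst_mono /psi /= !delta !one mul1r mulr1.
Qed.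

End Univ.

Definition amon (m : {ffun 'I_6 -> int}) : mon := (m, 0).
Definition bmon (n : {ffun 'I_6 -> int}) : mon := (0, n).

Lemma pairing_aa m M : pairing (amon m) M = 0.
Proof. by apply: big1 => i _; rewrite ffunE mul0r. Qed.

Lemma pairing_bb n M : pairing M (bmon n) = 0.
Proof. by apply: big1 => i _; rewrite ffunE mulr0. Qed.

Lemma mono_ab m n : mono hq (amon m) * mono hq (bmon n) = mono hq (m, n).
Proof.
by rewrite monoM pairing_aa oppr0 scale1r /amon /bmon; congr mono;
  congr pair; rewrite ?addr0 ?add0r.
Qed.

Lemma mono_ba m n : mono hq (bmon n) * mono hq (amon m) =
  q ^ (- \sum_i n i * m i) *: mono hq (m, n).
Proof.
by rewrite monoM; congr (_ *: mono hq _); rewrite /amon /bmon; congr pair;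
  rewrite ?addr0 ?add0r.
Qed.

Lemma mono_aD m m' :
  mono hq (amon (m + m')) = mono hq (amon m) * mono hq (amon m').
Proof.
rewrite monoM pairing_aa oppr0 scale1r; congr mono.
by rewrite /amon; congr pair; rewrite addr0.
Qed.

Lemma mono_bD n n' :
  mono hq (bmon (n + n')) = mono hq (bmon n) * mono hq (bmon n').
Proof.
rewrite monoM pairing_bb oppr0 scale1r; congr mono.
by rewrite /bmon; congr pair; rewrite addr0.
Qed.

Lemma mono_exp (e : {ffun 'I_6 -> int} -> Q) :
  {morph e : m n / m + n >-> m * n} -> (forall m, e m \is a GRing.unit) ->
  [/\ e 0 = 1, forall m, e (- m) = (e m)^-1 &
      forall m z, e (m *~ z) = e m ^ z].
Proof.
move=> eD eU; have e0 : e 0 = 1.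
  by apply: (mulrI (eU 0)); rewrite -eD addr0 mulr1.
have eN m : e (- m) = (e m)^-1.
  by apply: (mulrI (eU m)); rewrite -eD subrr divrr.
split=> // m z; have en n : e (m *+ n) = e m ^+ n.
  by elim: n => // n IH; rewrite mulrS exprS eD IH.
case: z => n; first exact: en.
by rewrite NegzE mulrNz eN -exprnN; congr _^-1; exact: en.
Qed.

Lemma mono_gen M :
  mono hq M = \prod_i agen i ^ M.1 i * \prod_i bgen i ^ M.2 i.
Proof.
have [a0 aN aX] := mono_exp mono_aD (fun m => mono_unit (amon m)).
have [b0 bN bX] := mono_exp mono_bD (fun m => mono_unit (bmon m)).
have delta (m : {ffun 'I_6 -> int}) :
    m = \sum_i [ffun j => (j == i)%:R : int] *~ m i.
  apply/ffunP => k; rewrite sum_ffunE (bigD1 k) //= big1 ?addr0.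
    by rewrite ffunMzE ffunE eqxx intz.
  by move=> i; rewrite ffunMzE ffunE eq_sym => /negPf->; rewrite mul0rz.
case: M => m n; rewrite -mono_ab /= [in LHS](delta m) [in LHS](delta n).
rewrite (big_morph (fun m => mono hq (amon m)) mono_aD a0).
rewrite (big_morph (fun m => mono hq (bmon m)) mono_bD b0).
by congr (_ * _); apply: eq_bigr => i _; rewrite ?aX ?bX.
Qed.

Lemma qrel_mono (al be : 'I_6 -> {ffun 'I_6 -> int}) :
  (forall i j, \sum_k be j k * al i k = (i == j)%:R) ->
  qrel (fun i => mono hq (amon (al i))) (fun j => mono hq (bmon (be j))).
Proof.
move=> h; split=> [i|i j|i j|i j]; first by rewrite !mono_unit.
- by rewrite -!mono_aD addrC.
- by rewrite -!mono_bD addrC.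
rewrite mono_ab; apply/esym.
apply: etrans (congr1 (fun x => _ *: x) (mono_ba _ _)) _; rewrite h scalerA.
by case: eqP => _; rewrite ?mul1r ?scale1r // mulfV ?scale1r.
Qed.

Lemma gen_qrel : qrel agen bgen.
Proof.
apply: qrel_mono => i j; rewrite (bigD1 j) //= big1 ?addr0 => [|k /negPf kj].
  by rewrite !ffunE eqxx mul1r eq_sym.
by rewrite !ffunE kj mul0r.
Qed.

Lemma qtorus_hom_ext (B : unitAlgType C) (f g : {lrmorphism Q -> B}) :
  (forall i, f (agen i) = g (agen i) /\ f (bgen i) = g (bgen i)) -> f =1 g.
Proof.
move=> fg x; rewrite [x]monoE [LHS]linear_sum [RHS]linear_sum.
apply: eq_bigr => M _ /=.
rewrite mono_gen [LHS]linearZZ [RHS]linearZZ !rmorphM !rmorph_prod.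
have gU M' : mono hq M' \is a GRing.unit := mono_unit M'.
congr (_ *: (_ * _)); apply: eq_bigr => i _.
  apply: etrans (rmorphXz f _ (gU _)) _.
  apply: etrans (esym (rmorphXz g _ (gU _))).
  exact: (congr1 (fun z => z ^ _) (fg i).1).
apply: etrans (rmorphXz f _ (gU _)) _.
apply: etrans (esym (rmorphXz g _ (gU _))).
exact: (congr1 (fun z => z ^ _) (fg i).2).
Qed.

End Presentation.

Record triple := Triple {
  ti : 'I_6; tj : 'I_6; tk : 'I_6; triple_lt : (ti < tj < tk)%N }.

Lemma triple_neq t : [/\ ti t != tj t, tj t != tk t & ti t != tk t].
Proof.
case: t => i j k /= /andP[ij jk]; rewrite -!val_eqE /=.
by rewrite (ltn_eqF ij) (ltn_eqF jk) (ltn_eqF (ltn_trans ij jk)).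
Qed.

Notation lab n := (@Ordinal 6 n.-1 isT).
Definition t123 := @Triple (lab 1) (lab 2) (lab 3) isT.
Definition t145 := @Triple (lab 1) (lab 4) (lab 5) isT.
Definition t246 := @Triple (lab 2) (lab 4) (lab 6) isT.
Definition t356 := @Triple (lab 3) (lab 5) (lab 6) isT.

Section Automorphisms.
Context (C : fieldType) (q : C) (hq : q != 0).
Local Notation Q := (qtorus hq).
Local Notation a := (agen hq).
Local Notation b := (bgen hq).

Definition Fa (t : triple) (l : 'I_6) : Q :=
  if l == tj t then a (ti t) * a (tk t)
  else if l == tk t then (a (ti t))^-1 * a (tj t)
  else a l.

Definition Fb (t : triple) (l : 'I_6) : Q :=
  if l == ti t then b (ti t) * b (tj t) * (b (tk t))^-1
  else if l == tj t then b (tk t)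
  else if l == tk t then b (tj t)
  else b l.

Definition F (t : triple) : Q -> Q := qsubst (Fa t) (Fb t).

Let d (i : 'I_6) : {ffun 'I_6 -> int} := [ffun j => (j == i)%:R].

Let dd x y : \sum_k d x k * d y k = (x == y)%:R.
Proof.
rewrite (bigD1 y) //= big1 ?addr0 => [|k /negPf ky].
  by rewrite !ffunE eqxx mulr1 eq_sym.
by rewrite !ffunE ky mulr0.
Qed.

Lemma F_qrel t : qrel q (Fa t) (Fb t).
Proof.
have [] := triple_neq t; rewrite /Fa /Fb.
case: t => i j k /= _ ij jk ik.
pose al l := if l == j then d i + d k else if l == k then - d i + d j else d l.
pose be l := if l == i then d i + d j - d k else
  if l == j then d k else if l == k then d j else d l.
have [_ aN _] := mono_exp (mono_aD hq) (fun m => mono_unit hq (amon m)).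
have [_ bN _] := mono_exp (mono_bD hq) (fun m => mono_unit hq (bmon m)).
suff h l l' : \sum_x be l' x * al l x = (l == l')%:R.
  have := qrel_mono hq h; congr qrel; apply/funext => l.
    rewrite /al; case: ifP => _; first by rewrite mono_aD.
    by case: ifP => _ //; rewrite mono_aD aN.
  rewrite /be; case: ifP => _; first by rewrite !mono_bD bN.
  by case: ifP => _ //; case: ifP.
pose p (m n : {ffun 'I_6 -> int}) := \sum_x m x * n x.
have pDl m m' n : p (m + m') n = p m n + p m' n.
  by rewrite -big_split; apply: eq_bigr => x _; rewrite ffunE mulrDl.
have pDr m n n' : p m (n + n') = p m n + p m n'.
  by rewrite -big_split; apply: eq_bigr => x _; rewrite ffunE mulrDr.
have pNl m n : p (- m) n = - p m n.
  by rewrite -sumrN; apply: eq_bigr => x _; rewrite ffunE mulNr.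
have pNr m n : p m (- n) = - p m n.
  by rewrite -sumrN; apply: eq_bigr => x _; rewrite ffunE mulrN.
rewrite -/(p _ _) /al /be.
have E := (eqxx, negPf ij, negPf jk, negPf ik,
  eq_sym j i, eq_sym k j, eq_sym k i).
have pd x y : p (d x) (d y) = (x == y)%:R := dd x y.
have cs x : [\/ x = i, x = j, x = k | [/\ x != i, x != j & x != k]].
  have [->|xi] := eqVneq x i; first by constructor 1.
  have [->|xj] := eqVneq x j; first by constructor 2.
  by have [->|xk] := eqVneq x k; [constructor 3 | constructor 4].
have [el|el|el|[/negPf l1 /negPf l2 /negPf l3]] := cs l;
have [el'|el'|el'|[/negPf m1 /negPf m2 /negPf m3]] := cs l';
  rewrite ?el ?el' ?E ?l1 ?l2 ?l3 ?m1 ?m2 ?m3 ?E ?(pDl, pDr, pNl, pNr) !pd ?E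
    ?l1 ?l2 ?l3 ?m1 ?m2 ?m3 //.
all: by rewrite ?[_ == l']eq_sym ?[_ == l]eq_sym ?l1 ?l2 ?l3 ?m1 ?m2 ?m3 //
  eq_sym.
Qed.

Lemma F_is_linear t : linear (F t).
Proof. exact: qsubst_is_linear. Qed.

Lemma F_is_monoid_morphism t : monoid_morphism (F t).
Proof. exact: qsubst_is_monoid_morphism (F_qrel t). Qed.

HB.instance Definition _ t :=
  GRing.isLinear.Build C Q Q *:%R (F t) (F_is_linear t).
HB.instance Definition _ t :=
  GRing.isMonoidMorphism.Build Q Q (F t) (F_is_monoid_morphism t).

Lemma F_a t l : F t (a l) = Fa t l.
Proof. by case: (qsubst_morph hq (F_qrel t)) => _ [_ /(_ l)[]]. Qed.

Lemma F_b t l : F t (b l) = Fb t l.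
Proof. by case: (qsubst_morph hq (F_qrel t)) => _ [_ /(_ l)[]]. Qed.

Lemma F_involutive t : involutive (F t).
Proof.
have au l : a l \is a GRing.unit := mono_unit hq _.
have bu l : b l \is a GRing.unit := mono_unit hq _.
have [_ _ bC _] := gen_qrel hq.
have FM x y : F t (x * y) = F t x * F t y := rmorphM (F t) x y.
have FV x : x \is a GRing.unit -> F t x^-1 = (F t x)^-1 := @rmorphV _ _ (F t) x.
apply: (qtorus_hom_ext (f := F t \o F t) (g := idfun)) => l /=.
have [ij jk ik] := triple_neq t.
have E := (eqxx, negPf ij, negPf jk, negPf ik, eq_sym (tj t) (ti t),
  eq_sym (tk t) (tj t), eq_sym (tk t) (ti t)).
split.
  rewrite F_a /Fa; have [->|lj] := eqVneq l (tj t).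
    by rewrite FM !F_a /Fa !E mulVKr.
  have [->|lk] := eqVneq l (tk t).
    by rewrite FM FV // !F_a /Fa !E mulKr.
  by rewrite F_a /Fa (negPf lj) (negPf lk).
rewrite F_b /Fb; have [->|li] := eqVneq l (ti t).
  rewrite !FM FV // !F_b /Fb !E.
  by rewrite divrK // mulrK.
have [->|lj] := eqVneq l (tj t); first by rewrite F_b /Fb !E.
have [->|lk] := eqVneq l (tk t); first by rewrite F_b /Fb !E.
by rewrite F_b /Fb (negPf li) (negPf lj) (negPf lk).
Qed.

Inductive in_G : (Q -> Q) -> Prop :=
| in_G_F t : in_G (F t)
| in_G_id : in_G id
| in_G_comp g h : in_G g -> in_G h -> in_G (g \o h)
| in_G_inv g h : in_G g -> cancel g h -> cancel h g -> in_G h.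

Lemma in_G_bij g : in_G g -> exists h, [/\ in_G h, cancel g h & cancel h g].
Proof.
elim=> [t||{}g h _ [g' [Gg gK Kg]] _ [h' [Gh hK Kh]]|{}g h Gg _ gK Kg].
- by exists (F t); split; [exact: in_G_F|exact: F_involutive..].
- by exists id; split; [exact: in_G_id| |].
- exists (h' \o g'); split; first exact: in_G_comp.
    exact: can_comp.
  exact: can_comp.
- by exists g.
Qed.

End Automorphisms.

Definition G (C : fieldType) (q : C) (hq : q != 0) : Type := {g | @in_G C q hq g}.

Section Group.
Context (C : fieldType) (q : C) (hq : q != 0).
Local Notation Q := (qtorus hq).
Local Notation G := (G hq).

HB.instance Definition _ := gen_eqMixin G.
HB.instance Definition _ := gen_choiceMixin G.

Implicit Types g h : G.

Definition Ggen t : G := exist _ _ (in_G_F hq t).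
Definition Gone : G := exist _ _ (in_G_id hq).
Definition Gmul g h : G := exist _ _ (in_G_comp (svalP g) (svalP h)).
Definition Ginv g : G :=
  let: exist h hP := cid (in_G_bij (svalP g)) in
  exist _ h (let: And3 Gh _ _ := hP in Gh).

Lemma GinvK g : cancel (sval g) (sval (Ginv g)).
Proof. by rewrite /Ginv; case: cid => h []. Qed.

Lemma GKinv g : cancel (sval (Ginv g)) (sval g).
Proof. by rewrite /Ginv; case: cid => h []. Qed.

Lemma G_eq g h : sval g =1 sval h -> g = h.
Proof. by case: g h => [g gP] [h hP] /= /funext; apply: eq_exist. Qed.

Lemma GmulA : associative Gmul. Proof. by move=> *; apply: G_eq. Qed.
Lemma Gmul1 : left_id Gone Gmul. Proof. by move=> *; apply: G_eq. Qed.
Lemma Gmulx1 : right_id Gone Gmul. Proof. by move=> *; apply: G_eq. Qed.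
Lemma GmulV : left_inverse Gone Ginv Gmul.
Proof. by move=> g; apply: G_eq => x; apply: GinvK. Qed.
Lemma GmulxV : right_inverse Gone Ginv Gmul.
Proof. by move=> g; apply: G_eq => x; apply: GKinv. Qed.

HB.instance Definition _ := isGroup.Build G GmulA Gmul1 Gmulx1 GmulV GmulxV.

End Group.

(** Formal C-linear combinations of the basis elements gM (g in G, M a basis
    monomial), given by their coefficients.  [None] stands for an infinite sum or
    product that is not defined, some basis element receiving infinitely many
    contributions. *)
Definition series (C : fieldType) (q : C) (hq : q != 0) : Type :=
  option (G hq * mon -> C).

Section Series.
Context (C : fieldType) (q : C) (hq : q != 0).
Local Notation Q := (qtorus hq).
Local Notation G := (G hq).

(** A pair (g, x) : G * Q is the element g x of the skew group algebra; the rule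
    h y = h(y) h gives (g x) (h y) = g h h^-1(x) y. *)
Definition skew_mul (u v : G * Q) : G * Q :=
  ((u.1 * v.1)%g, sval (v.1^-1)%g u.2 * v.2).

Definition skew_coef (u : G * Q) (e : G * mon) : C :=
  if u.1 == e.1 then u.2@_(e.2) else 0.

(** The contribution to the basis element e of the choice of one term in each
    factor, namely the multiple of the basis element t_i in the factor s_i. *)
Definition contribution (s : seq (G * mon -> C)) (t : seq (G * mon))
    (e : G * mon) : C :=
  (\prod_(ft <- zip s t) ft.1 ft.2) *
  skew_coef (foldr skew_mul (1%g, 1) [seq (gM.1, mono hq gM.2) | gM <- t]) e.

Definition sprod (s : seq (series hq)) : series hq :=
  let s' := pmap id s in
  if all isSome s &&
     `[< forall e, finite_set
           [set t | size t = size s' /\ contribution s' t e != 0] >]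
  then Some (fun e => \sum_(t \in [set t | size t = size s'])
                        contribution s' t e)
  else None.

Definition sgroup (g : G) : series hq :=
  Some (fun e => (e == (g, 0))%:R).

(** The series <x>_p in the variable x, evaluated at an element x of Q. *)
Definition qexp (p : C) (x : Q) : series hq :=
  let term n : Q := (\prod_(1 <= i < n.+1) (1 - p ^+ i))^-1 *: (- x) ^+ n in
  if `[< forall M, finite_set [set n | (term n)@_M != 0] >]
  then Some (fun e => \sum_(n \in [set: nat]) skew_coef (1%g, term n) e)
  else None.

Definition tetrahedron (R : triple -> C -> series hq) (lam mu nu : C) : Prop :=
  exists S,
    sprod [:: R t123 lam; R t145 (lam * mu); R t246 nu; R t356 mu] = Some S /\
    sprod [:: R t356 nu; R t246 mu; R t145 (lam * nu); R t123 lam] = Some S.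

End Series.

(* Main.v *)
Require Import Defs.
From HB Require Import structures.
From mathcomp Require Import all_boot all_order all_algebra finmap.
From mathcomp Require Import multinomials.monalg.
From mathcomp Require Import boolp classical_sets functions cardinality fsbigop.
From mathcomp Require Import complex reals.
From mathcomp Require Import ring lra zify.

Set Implicit Arguments.
Unset Strict Implicit.
Unset Printing Implicit Defensive.

Import Order.TTheory GRing.Theory Num.Theory.

Local Open Scope ring_scope.

(** Moving all group elements to the left turns both sides of the tetrahedron
    equation into F123 F145 F246 F356 times a product of quantum exponentials.
    With u = x123, v = x356 and w = F356(x246), where vu = Q uv, uw = Q wu and
    wv = Q vw, the left side becomes <u> <uv> <w> <v> and the right side becomes
    <w> <v> <wu> <u>.  As uv commutes with w and wu with v, both are equal to
    <w> <wu> <u> <uv> <v> by the pentagon identity <v> <u> = <u> <uv> <v>,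
    applied to (u, v) and to (w, u).  Read off componentwise, the pentagon
    identity is the q-binomial theorem.

    In part (ii) every hatted monomial commutes with every unhatted one, so the
    components of the two families multiply.  Part (i) is the case of (ii) with
    alpha^ = - delta, beta^ = beta, delta^ = - alpha in which the series f is
    evaluated at 0.

    A basis element receives finitely many contributions because the exponents
    of u, v, w and of their hatted analogues are linearly independent. *)

(** * The pentagon identity *)

(** Both sums run over the indices up to the minimum of [m] and [n]. The exchange of bound and
    condition serves to bring two truncated sums to a common range. *)
Lemma sum_ord_leqC (V : nmodType) (m n : nat) (t : nat -> V) :
  \sum_(i < m.+1 | (i <= n)%N) t i = \sum_(i < n.+1 | (i <= m)%N) t i.
Proof.
rewrite (big_ord_widen_cond (m + n).+1 (fun i => i <= n)%N) ?ltnS ?leq_addr //.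
rewrite [RHS](big_ord_widen_cond (m + n).+1 (fun i => i <= m)%N) ?ltnS;
  last exact: leq_addl.
by apply: eq_bigl => i; rewrite !ltnS andbC.
Qed.

Lemma scale_mul4 (C : fieldType) (A : algType C) (x y z t : A) (k l m n : C) :
  (k *: x) * (l *: y) * (m *: z) * (n *: t) =
  (k * l * m * n) *: (x * y * z * t).
Proof.
have e2 (c1 c2 : C) (x1 x2 : A) :
    (c1 *: x1) * (c2 *: x2) = (c1 * c2) *: (x1 * x2).
  by rewrite -scalerAl -scalerAr scalerA.
by rewrite !e2.
Qed.

Lemma comm_scaleX (C : fieldType) (A : algType C) (c d : C) (u v : A) m n :
  GRing.comm u v ->
  GRing.comm (c *: u ^+ m) (d *: v ^+ n).
Proof.
move=> uv; rewrite /GRing.comm -!scalerAl -!scalerAr !scalerA (mulrC c).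
by congr (_ *: _); apply/commrX/commr_sym/commrX/commr_sym.
Qed.

Section Pentagon.
Context (C : fieldType) (p : C) (hp : forall n, (0 < n)%N -> p ^+ n != 1).

(** The q-Pochhammer symbol $(p;p)_n$, the denominator in $\langle x\rangle_p$. *)
Definition qpoch (n : nat) : C := \prod_(1 <= i < n.+1) (1 - p ^+ i).

(** The coefficient of $x^n$ in $\langle x\rangle_p$, with the sign of $(-x)^n$ absorbed. *)
Definition qexp_coef (n : nat) : C := (qpoch n)^-1 * (-1) ^+ n.

Lemma qpochS n : qpoch n.+1 = qpoch n * (1 - p ^+ n.+1).
Proof. by rewrite /qpoch big_nat_recr. Qed.

Lemma qpoch0 : qpoch 0 = 1.
Proof. by rewrite /qpoch big_geq. Qed.

Lemma subr1X_neq0 n : 1 - p ^+ n.+1 != 0.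
Proof. by rewrite subr_eq0 eq_sym hp. Qed.

Lemma qpoch_neq0 n : qpoch n != 0.
Proof.
elim: n => [|n IH]; first by rewrite qpoch0 oner_eq0.
by rewrite qpochS mulf_neq0 // subr1X_neq0.
Qed.

(** Cauchy's form of the q-binomial theorem, $y^a = \sum_j \binom{a}{j}_p \prod_{i<j}(y - p^i)$,
    divided by $(p;p)_a$. The induction on [a] compares the two sides after multiplication by $1 -
    p^{a+1}$. *)
Lemma cauchy_binomial (y : C) a :
  \sum_(j < a.+1) \prod_(i < j) (y - p ^+ i) / (qpoch (a - j) * qpoch j) =
  y ^+ a / qpoch a.
Proof.
elim: a => [|a IH].
  by rewrite big_ord1 big_ord0 subnn qpoch0 mulr1.
apply: (mulfI (subr1X_neq0 a)).
have -> : (1 - p ^+ a.+1) * (y ^+ a.+1 / qpoch a.+1) = y * (y ^+ a / qpoch a).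
  by rewrite qpochS (exprS y); field; rewrite qpoch_neq0 subr1X_neq0.
rewrite -IH.
pose c j := \prod_(i < j) (y - p ^+ i).
(* Writing [y] as $(y - p^j) + p^j$ turns [y * c j] into [c j.+1 + p ^+ j * c j]. *)
have -> : y * \sum_(j < a.+1) c j / (qpoch (a - j) * qpoch j) =
    \sum_(j < a.+1) c j.+1 / (qpoch (a - j) * qpoch j) +
    \sum_(j < a.+1) p ^+ j * c j / (qpoch (a - j) * qpoch j).
  rewrite mulr_sumr -big_split; apply: eq_bigr => j _ /=.
  by rewrite /c big_ord_recr /=; ring.
(* The splitting $1 - p^{a+1} = (1 - p^j) + p^j(1 - p^{a+1-j})$ is made so that each part cancels
   the last factor of one of the two q-Pochhammer symbols. *)
have -> : (1 - p ^+ a.+1) *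
    (\sum_(j < a.+2) c j / (qpoch (a.+1 - j) * qpoch j)) =
    \sum_(j < a.+2) (1 - p ^+ j) * c j / (qpoch (a.+1 - j) * qpoch j) +
    \sum_(j < a.+2) p ^+ j * (1 - p ^+ (a.+1 - j)) * c j
       / (qpoch (a.+1 - j) * qpoch j).
  rewrite mulr_sumr -big_split; apply: eq_bigr => j _ /=.
  have -> : p ^+ a.+1 = p ^+ j * p ^+ (a.+1 - j).
    by rewrite -exprD subnKC // -ltnS.
  by ring.
congr (_ + _).
  (* The term [j = 0] vanishes here, and the rest is shifted by one; in the other sum it is the last
     term, [j = a + 1], that vanishes. *)
  rewrite big_ord_recl expr0 subrr !mul0r add0r; apply: eq_bigr => j _.
  rewrite lift0 subSS qpochS.
  rewrite [_ * c _]mulrC -!mulrA; congr (_ * _).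
  by field; rewrite !qpoch_neq0 subr1X_neq0.
rewrite big_ord_recr /= subnn expr0 subrr mulr0 !mul0r addr0.
apply: eq_bigr => j _ /=; rewrite subSn; last by rewrite -ltnS.
rewrite qpochS.
by field; rewrite !qpoch_neq0 subr1X_neq0.
Qed.

(** Each factor $p^b - p^i = -p^i(1 - p^{b-i})$ cancels one factor of $(p;p)_b$ and contributes a
    sign and $p^i$; the exponents [i < j] add up to ['C(j, 2)]. *)
Lemma qexp_coefB b j : (j <= b)%N ->
  qexp_coef (b - j) * p ^+ 'C(j, 2) =
  qexp_coef b * \prod_(i < j) (p ^+ b - p ^+ i).
Proof.
elim: j => [_|j IH jb]; first by rewrite subn0 big_ord0 expr0.
rewrite big_ord_recr /= mulrA -IH ?(ltnW jb) // binS bin1 exprD.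
rewrite [(b - j)%N](_ : _ = (b - j.+1).+1); last by rewrite -subSn ?subSS.
rewrite /qexp_coef qpochS.
have -> : p ^+ b = p ^+ j * p ^+ (b - j.+1).+1.
  by rewrite -exprD; congr (_ ^+ _); lia.
rewrite [X in _ = _ * X](_ : _ = - (p ^+ j * (1 - p ^+ (b - j.+1).+1))).
  rewrite (exprS (-1)).
  by field; rewrite qpoch_neq0 subr1X_neq0.
by rewrite mulrBr mulr1 opprB.
Qed.

(** This is [cauchy_binomial] at $y = p^b$, with the products rewritten by [qexp_coefB]. *)
Lemma pentagon_coef a b :
  \sum_(j < a.+1 | (j <= b)%N)
    qexp_coef (a - j) * qexp_coef j * qexp_coef (b - j) * p ^+ 'C(j, 2) =
  qexp_coef a * qexp_coef b * p ^+ (a * b).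
Proof.
transitivity (\sum_(j < a.+1) qexp_coef (a - j) * qexp_coef j *
    (qexp_coef b * \prod_(i < j) (p ^+ b - p ^+ i))).
  rewrite [RHS](bigID (fun j : 'I_ _ => (j <= b)%N)) /=.
  rewrite [X in _ = _ + X]big1 ?addr0.
    by apply: eq_bigr => j jb; rewrite -qexp_coefB // !mulrA.
  (* For [j > b] the product contains the factor with [i = b], which is zero, so the truncation at
     [b] loses nothing. *)
  move=> j; rewrite -ltnNge => bj.
  by rewrite (bigD1 (Ordinal bj)) //= subrr mul0r !mulr0.
transitivity (qexp_coef b * (-1) ^+ a * (\sum_(j < a.+1)
    \prod_(i < j) (p ^+ b - p ^+ i) / (qpoch (a - j) * qpoch j))).
  rewrite mulr_sumr; apply: eq_bigr => j _; rewrite /qexp_coef.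
  have -> : (-1) ^+ a = (-1) ^+ (a - j) * (-1) ^+ j :> C.
    by rewrite -exprD subnK // -ltnS.
  by field; rewrite !qpoch_neq0.
by rewrite cauchy_binomial -exprM [(b * a)%N]mulnC /qexp_coef; ring.
Qed.

Context (A : algType C).
Implicit Types u v w : A.

Lemma qcommX c u v a b : v * u = c *: (u * v) ->
  v ^+ b * u ^+ a = c ^+ (a * b) *: (u ^+ a * v ^+ b).
Proof.
have one (d : C) (x y : A) n :
    y * x = d *: (x * y) -> y ^+ n * x = d ^+ n *: (x * y ^+ n).
  move=> h; elim: n => [|n IH]; first by rewrite !expr0 mul1r mulr1 scale1r.
  rewrite exprS -mulrA IH -scalerAr (mulrA y) h -scalerAl scalerA -(mulrA x).
  by rewrite -exprSr.
move=> /(one _ _ _ b) h; elim: a => [|a IH].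
  by rewrite !expr0 mul1r mulr1 scale1r.
rewrite exprS (mulrA (v ^+ b)) h -scalerAl -(mulrA u (v ^+ b)) IH.
rewrite -scalerAr scalerA !mulrA.
by rewrite mulSn exprD.
Qed.

(** Collecting the [u]'s on the left moves the one in the k-th factor past k - 1 copies of [v],
    hence the exponent ['C(n, 2)]. *)
Lemma exprM_qcomm c u v n : v * u = c *: (u * v) ->
  (u * v) ^+ n = c ^+ 'C(n, 2) *: (u ^+ n * v ^+ n).
Proof.
move=> h; elim: n => [|n IH]; first by rewrite !expr0 mulr1 scale1r.
rewrite exprSr IH -scalerAl -mulrA [in X in _ *: X](mulrA (v ^+ n)).
rewrite -[X in v ^+ n * X]expr1 (qcommX _ _ h) mul1n -scalerAl -scalerAr.
by rewrite scalerA -exprD binS bin1 expr1 !mulrA -exprSr -mulrA -exprSr.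
Qed.

(** The part of degree [a] in [u] and [b] in [v] of the pentagon identity; [j] is the degree in
    [u * v]. Once all monomials are ordered, only the scalar identity [pentagon_coef] is left. *)
Lemma pentagon u v a b : v * u = p *: (u * v) ->
  \sum_(j < a.+1 | (j <= b)%N) qexp_coef (a - j) * qexp_coef j *
    qexp_coef (b - j) *: (u ^+ (a - j) * (u * v) ^+ j * v ^+ (b - j)) =
  qexp_coef a * qexp_coef b *: (v ^+ b * u ^+ a).
Proof.
move=> h; rewrite (qcommX _ _ h) scalerA -pentagon_coef scaler_suml.
apply: eq_bigr => j jb; rewrite (exprM_qcomm _ h) -scalerAr -scalerAl scalerA.
congr (_ *: _); have ja : (j <= a)%N by rewrite -ltnS.
by rewrite !mulrA -exprD subnK // -mulrA -exprD subnKC.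
Qed.

Lemma tetrahedron_component u v w a b c :
  v * u = p *: (u * v) -> u * w = p *: (w * u) -> w * v = p *: (v * w) ->
  p != 0 ->
  \sum_(j < a.+1 | (j <= b)%N)
    (qexp_coef (a - j) *: u ^+ (a - j)) * (qexp_coef j *: (u * v) ^+ j) *
    (qexp_coef c *: w ^+ c) * (qexp_coef (b - j) *: v ^+ (b - j)) =
  \sum_(i < a.+1 | (i <= c)%N)
    (qexp_coef (c - i) *: w ^+ (c - i)) * (qexp_coef b *: v ^+ b) *
    (qexp_coef i *: (w * u) ^+ i) * (qexp_coef (a - i) *: u ^+ (a - i)).
Proof.
move=> vu uw wv p0.
(* Passing [w] through [u] and through [v] produces inverse factors, which cancel. The same happens
   to [v] passing through [w] and [u]. *)
have cXw : GRing.comm (u * v) w.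
  rewrite /GRing.comm -mulrA; apply: (scalerI p0).
  by rewrite scalerAr -wv (mulrA u w) uw -scalerAl -(mulrA w u).
have cvY : GRing.comm v (w * u).
  rewrite /GRing.comm; apply: (scalerI p0).
  by rewrite (mulrA v) scalerAl -wv -(mulrA w v) vu -scalerAr (mulrA w u).
(* The common middle term is the component of [<w> <wu> <u> <uv> <v>]: [i] and [j] are the degrees
   in [w * u] and [u * v], and [i + j <= a] because each of these products takes one [u]. *)
transitivity (\sum_(j < a.+1 | (j <= b)%N)
   \sum_(i < a.+1 | (i <= c)%N && (i + j <= a)%N)
    (qexp_coef (c - i) * qexp_coef i * qexp_coef (a - i - j) *
     qexp_coef j * qexp_coef (b - j)) *:
    (w ^+ (c - i) * (w * u) ^+ i * u ^+ (a - i - j) * (u * v) ^+ j *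
     v ^+ (b - j))).
  apply: eq_bigr => j jb; rewrite scale_mul4.
  have ja : (j <= a)%N by rewrite -ltnS.
  have cX : GRing.comm ((u * v) ^+ j) (w ^+ c).
    by apply/commrX/commr_sym/commrX/commr_sym.
  have -> : u ^+ (a - j) * (u * v) ^+ j * w ^+ c * v ^+ (b - j) =
      u ^+ (a - j) * w ^+ c * (u * v) ^+ j * v ^+ (b - j).
    by rewrite -(mulrA (u ^+ _)) cX !mulrA.
  rewrite [X in X *: _](_ : _ = (qexp_coef j * qexp_coef (b - j)) *
    (qexp_coef c * qexp_coef (a - j))); last by ring.
  rewrite -scalerA 2!(scalerAl (qexp_coef c * _)) -(pentagon c (a - j) uw).
  rewrite 2!mulr_suml scaler_sumr.
  pose t (i : nat) := qexp_coef j * qexp_coef (b - j) *: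
    ((qexp_coef (c - i) * qexp_coef i * qexp_coef (a - j - i)) *:
     (w ^+ (c - i) * (w * u) ^+ i * u ^+ (a - j - i)) * (u * v) ^+ j *
     v ^+ (b - j)).
  transitivity (\sum_(i < c.+1 | (i <= a - j)%N) t i); first by [].
  (* [pentagon] bounds [i] by [c] under the condition [i <= a - j]; after the exchange the range can
     be widened to [a.+1], as in the other expansion. *)
  rewrite sum_ord_leqC.
  rewrite (big_ord_widen_cond a.+1 (fun i => i <= c)%N); last first.
    by rewrite ltnS leq_subr.
  apply: eq_big => [i|i /andP[ic ia]].
    by rewrite ltnS leq_subRL ?[(j + i)%N]addnC.
  rewrite /t -!scalerAl scalerA subnAC.
  by congr (_ *: _); ring.
rewrite (exchange_big_dep (fun i : 'I_a.+1 => i <= c)%N) /=; last first.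
  by move=> j i jb /andP[].
apply: eq_bigr => i ic; rewrite scale_mul4.
have ia : (i <= a)%N by rewrite -ltnS.
have -> : w ^+ (c - i) * v ^+ b * (w * u) ^+ i * u ^+ (a - i) =
    w ^+ (c - i) * (w * u) ^+ i * (v ^+ b * u ^+ (a - i)).
  have cY : GRing.comm (v ^+ b) ((w * u) ^+ i).
    by apply/commrX/commr_sym/commrX/commr_sym.
  by rewrite -(mulrA (w ^+ _)) cY !mulrA.
rewrite [X in _ = X *: _](_ : _ = (qexp_coef (c - i) * qexp_coef i) *
    (qexp_coef (a - i) * qexp_coef b)); last by ring.
rewrite -scalerA (scalerAr (qexp_coef (a - i) * _)) -(pentagon (a - i) b vu).
rewrite mulr_sumr scaler_sumr.
pose t (j : nat) := qexp_coef (c - i) * qexp_coef i *: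
    (w ^+ (c - i) * (w * u) ^+ i * ((qexp_coef (a - i - j) * qexp_coef j *
     qexp_coef (b - j)) *: (u ^+ (a - i - j) * (u * v) ^+ j * v ^+ (b - j)))).
transitivity (\sum_(j < (a - i).+1 | (j <= b)%N) t j); last by [].
rewrite (big_ord_widen_cond a.+1 (fun j => j <= b)%N); last first.
  by rewrite ltnS leq_subr.
apply: eq_big => [j|j /and3P[jb _ ja]].
  by rewrite ic ltnS leq_subRL.
by rewrite /t -scalerAr scalerA !mulrA; congr (_ *: _); ring.
Qed.

End Pentagon.

(* In a pair of exponents the first component belongs to the unhatted family,
   the second one to the hatted family. *)
Definition split_range (A B : nat * nat) : seq (nat * nat) :=
  [seq (i, j) | i <- [seq i <- iota 0 A.1.+1 | (i <= B.1)%N],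
                j <- [seq j <- iota 0 A.2.+1 | (j <= B.2)%N]].

Definition sub2 (A B : nat * nat) : nat * nat := ((A.1 - B.1)%N, (A.2 - B.2)%N).

Lemma mem_split_range A B i :
  (i \in split_range A B) =
    [&& (i.1 <= A.1)%N, (i.1 <= B.1)%N, (i.2 <= A.2)%N & (i.2 <= B.2)%N].
Proof.
case: i => i j; rewrite /split_range; apply/allpairsP/idP.
  move=> [[i' j']]; rewrite !mem_filter !mem_iota !ltnS.
  by move=> [/andP[ib /= ia] /andP[jb /= ja] [-> ->]]; apply/and4P.
move=> /and4P[ia ib ja jb]; exists (i, j).
by rewrite !mem_filter !mem_iota !ltnS; move: ia ib ja jb => /= -> -> -> ->.
Qed.

Lemma split_range_uniq A B : uniq (split_range A B).
Proof.
apply: allpairs_uniq; rewrite ?filter_uniq ?iota_uniq //.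
by move=> [? ?] [? ?] _ _ [-> ->].
Qed.

(** * Two mutually commuting families of q-commuting elements *)

Section DoublePentagon.
Context (C : fieldType) (A : algType C) (p p' : C).
Hypotheses (hp : forall n, (0 < n)%N -> p ^+ n != 1) (p0 : p != 0).
Hypotheses (hp' : forall n, (0 < n)%N -> p' ^+ n != 1) (p0' : p' != 0).

(** The term of bidegree [i] in $\langle u\rangle_p \langle u'\rangle_{p'}$. *)
Definition qexp_fam (u u' : A) (i : nat * nat) : A :=
  (qexp_coef p i.1 *: u ^+ i.1) * (qexp_coef p' i.2 *: u' ^+ i.2).

Lemma sum_split_range (F F' : nat -> A) (D E : nat * nat) :
  \sum_(i <- split_range D E) F i.1 * F' i.2 =
  (\sum_(i < D.1.+1 | (i <= E.1)%N) F i) *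
  (\sum_(i < D.2.+1 | (i <= E.2)%N) F' i).
Proof.
rewrite big_allpairs !big_filter mulr_suml.
rewrite -[iota 0 D.1.+1]/(index_iota 0 D.1.+1) big_mkord.
apply: eq_bigr => i _; rewrite big_filter mulr_sumr.
by rewrite -[iota 0 D.2.+1]/(index_iota 0 D.2.+1) big_mkord.
Qed.

(** Since the families commute, every summand separates into an unhatted and a hatted product, the
    sum over [split_range] factors, and [tetrahedron_component] applies to each factor. *)
Lemma tetrahedron_component_fam (u v w u' v' w' : A) (D E J : nat * nat) :
  v * u = p *: (u * v) -> u * w = p *: (w * u) -> w * v = p *: (v * w) ->
  v' * u' = p' *: (u' * v') -> u' * w' = p' *: (w' * u') ->
  w' * v' = p' *: (v' * w') ->
  (forall x y, x \in [:: u; v; w] -> y \in [:: u'; v'; w'] -> GRing.comm x y) ->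
  \sum_(i <- split_range D E) qexp_fam u u' (sub2 D i) *
     qexp_fam (u * v) (u' * v') i * qexp_fam w w' J * qexp_fam v v' (sub2 E i) =
  \sum_(i <- split_range D J) qexp_fam w w' (sub2 J i) * qexp_fam v v' E *
     qexp_fam (w * u) (w' * u') i * qexp_fam u u' (sub2 D i).
Proof.
move=> vu uw wv vu' uw' wv' c.
(* Each [x] only has to pass the [y]'s with a smaller index, which gives six commutations. *)
have e4 (x1 x2 x3 x4 y1 y2 y3 y4 : A) : GRing.comm x2 y1 -> GRing.comm x3 y1 ->
    GRing.comm x3 y2 -> GRing.comm x4 y1 -> GRing.comm x4 y2 ->
    GRing.comm x4 y3 ->
    (x1 * y1) * (x2 * y2) * (x3 * y3) * (x4 * y4) =
    (x1 * x2 * x3 * x4) * (y1 * y2 * y3 * y4).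
  move=> c21 c31 c32 c41 c42 c43; rewrite -!mulrA; congr (_ * _).
  rewrite !mulrA -c21 -!mulrA; congr (_ * _).
  rewrite !mulrA -(mulrA y1 y2) -c32 mulrA -c31 -!mulrA; congr (_ * _).
  rewrite !mulrA -(mulrA _ y3 x4) -c43 !mulrA -(mulrA _ y2 x4) -c42.
  by rewrite !mulrA -c41.
have [cuu cuv cuw] : [/\ GRing.comm u u', GRing.comm u v' & GRing.comm u w'].
  by split; apply: c; rewrite !inE eqxx ?orbT.
have [cvu cvv cvw] : [/\ GRing.comm v u', GRing.comm v v' & GRing.comm v w'].
  by split; apply: c; rewrite !inE eqxx ?orbT.
have [cwu cwv cww] : [/\ GRing.comm w u', GRing.comm w v' & GRing.comm w w'].
  by split; apply: c; rewrite !inE eqxx ?orbT.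
have cMl (x y z : A) : GRing.comm x z -> GRing.comm y z -> GRing.comm (x * y) z.
  by move=> xz yz; apply: commr_sym; apply: commrM; apply: commr_sym.
transitivity (\sum_(i <- split_range D E)
  (qexp_coef p (D.1 - i.1) *: u ^+ (D.1 - i.1) *
   (qexp_coef p i.1 *: (u * v) ^+ i.1) * (qexp_coef p J.1 *: w ^+ J.1) *
   (qexp_coef p (E.1 - i.1) *: v ^+ (E.1 - i.1))) *
  (qexp_coef p' (D.2 - i.2) *: u' ^+ (D.2 - i.2) *
   (qexp_coef p' i.2 *: (u' * v') ^+ i.2) * (qexp_coef p' J.2 *: w' ^+ J.2) *
   (qexp_coef p' (E.2 - i.2) *: v' ^+ (E.2 - i.2)))).
  apply: eq_bigr => i _; rewrite /qexp_fam /= e4 //; apply: comm_scaleX => //;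
  by do ?[exact: cuu | apply: cMl | apply: commrM].
rewrite (sum_split_range (fun i => (qexp_coef p (D.1 - i) *: u ^+ (D.1 - i) *
   (qexp_coef p i *: (u * v) ^+ i) * (qexp_coef p J.1 *: w ^+ J.1) *
   (qexp_coef p (E.1 - i) *: v ^+ (E.1 - i)))) (fun i =>
  (qexp_coef p' (D.2 - i) *: u' ^+ (D.2 - i) *
   (qexp_coef p' i *: (u' * v') ^+ i) * (qexp_coef p' J.2 *: w' ^+ J.2) *
   (qexp_coef p' (E.2 - i) *: v' ^+ (E.2 - i))))).
rewrite !tetrahedron_component // -(sum_split_range (fun i =>
  (qexp_coef p (J.1 - i) *: w ^+ (J.1 - i)) * (qexp_coef p E.1 *: v ^+ E.1) *
  (qexp_coef p i *: (w * u) ^+ i) * (qexp_coef p (D.1 - i) *: u ^+ (D.1 - i)))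
  (fun i =>
  (qexp_coef p' (J.2 - i) *: w' ^+ (J.2 - i)) *
  (qexp_coef p' E.2 *: v' ^+ E.2) * (qexp_coef p' i *: (w' * u') ^+ i) *
  (qexp_coef p' (D.2 - i) *: u' ^+ (D.2 - i)))).
apply: eq_bigr => i _; rewrite /qexp_fam /= e4 //; apply: comm_scaleX => //;
by do ?[exact: cuu | apply: cMl | apply: commrM].
Qed.

End DoublePentagon.

(** * Products of formal series *)

Section SeriesProducts.
Context (C : fieldType) (q : C) (hq : q != 0).
Local Notation Q := (qtorus hq).
Local Notation G := (G hq).
Local Notation T := (G * mon)%type.
Local Notation F := (@F C q hq).

Definition basis_prod (t : seq T) : G * Q :=
  foldr (@skew_mul C q hq) (1%g, 1) [seq (gM.1, mono hq gM.2) | gM <- t].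

Lemma mcoeff_mono (c : C) (M N : mon) :
  (c *: mono hq M)@_N = if M == N then c else 0.
Proof. by rewrite mcoeffZ mcoeffU mulr_natr; case: eqP. Qed.

(* [cov j] lists the choices of basis elements that can contribute to g E(j). *)
Lemma sprod_cover (s : seq (T -> C)) (J : eqType) (g : G) (E : J -> mon)
    (cov : J -> seq (seq T)) :
  injective E -> (forall j, uniq (cov j)) ->
  (forall j t, t \in cov j -> size t = size s /\
     exists c, basis_prod t = (g, c *: mono hq (E j))) ->
  (forall t, size t = size s -> \prod_(ft <- zip s t) ft.1 ft.2 != 0 ->
     exists j, t \in cov j) ->
  exists S, [/\ sprod (map Some s) = Some S,
    forall j, S (g, E j) *: mono hq (E j) =
      \sum_(t <- cov j) (\prod_(ft <- zip s t) ft.1 ft.2) *: (basis_prod t).2 &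
    forall e, S e != 0 -> exists j, e = (g, E j)].
Proof.
move=> Einj covU covE cov_all.
(* A choice with a nonzero contribution lies in some [cov j] and can only reach [(g, E j)]. *)
have key t e : size t = size s -> contribution s t e != 0 ->
    exists2 j, t \in cov j & e = (g, E j).
  move=> st; rewrite mulf_eq0 negb_or => /andP[/(cov_all _ st)[j tj]].
  have [_ [c tE]] := covE _ _ tj.
  rewrite -/(basis_prod t) /skew_coef tE /= mcoeff_mono.
  case: (g =P e.1) => [ge|_]; last by rewrite eqxx.
  case: (E j =P e.2) => [Ee|_]; last by rewrite eqxx.
  by move=> _; exists j => //; case: e ge Ee => ? ? /= <- <-.
have sE : pmap id (map Some s) = s by elim: s {covE cov_all key} => //= ? ? ->.
pose S e := \sum_(t \in [set t | size t = size s]%classic) contribution s t e.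
have SE j : S (g, E j) = \sum_(t <- cov j) contribution s t (g, E j).
  rewrite /S (fsbigE (cov j) _ (covU j)) //; first last.
  - move=> t /= st; apply: contraNeq => /(key _ _ st)[j' tj' [/Einj ->]] //.
  - by move=> t /= /covE[].
  rewrite big_seq_cond [RHS]big_seq_cond; apply: eq_bigl => t.
  by case tj: (t \in _) => //=; rewrite mem_set //=; case: (covE _ _ tj).
exists S; split=> [|j|e].
- rewrite /sprod sE; case: ifP => // /negP[]; apply/andP; split.
    by rewrite all_map; apply/allP.
  apply/asboolP => e.
  (* By injectivity of [E], the contributors to [(g, E j)] lie in the finite list [cov j]; any other
     basis element has none. *)
  have [[j ->]|ne] := pselect (exists j, e = (g, E j)).
    apply: (sub_finite_set (B := [set` cov j]%classic)) => [t /= [st]|].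
      by move=> /(key _ _ st)[j' tj' [/Einj ->]].
    exact: finite_seq.
  apply: (sub_finite_set (B := set0)) => [t /= [st]|]; last exact: finite_set0.
  by move=> /(key _ _ st)[j' _ ej]; apply: ne; exists j'.
- rewrite SE scaler_suml big_seq [RHS]big_seq; apply: eq_bigr => t tj.
  rewrite /contribution -/(basis_prod t).
  have [_ [c ->]] := covE _ _ tj.
  by rewrite /skew_coef /= eqxx mcoeff_mono eqxx scalerA.
- move=> Se; apply: contrapT => ne; move: Se.
  rewrite /S fsbig1 ?eqxx // => t st.
  by apply: contrapT => /eqP/(key _ _ st)[j' _ ej]; apply: ne; exists j'.
Qed.

(* Some [x i] may be 0, so that one index set serves both parts of the theorem. *)
Definition represents (I : Type) (r : series hq) (g : G) (M : I -> mon)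
    (x : I -> Q) : Prop :=
  exists f, [/\ r = Some f, forall i, f (g, M i) *: mono hq (M i) = x i &
    forall e, f e != 0 -> exists i, e = (g, M i)].

(** The scalar stays anonymous: to locate the basis element that receives a contribution, only the
    exponent is needed. *)
Lemma scale_monoM (c d : C) (M N : mon) :
  exists k, (c *: mono hq M) * (d *: mono hq N) = k *: mono hq (M + N).
Proof.
exists (c * d * q ^ (- pairing M N)).
by rewrite -scalerAl -scalerAr monoM !scalerA.
Qed.

Lemma scale_monoX (c : C) (N : mon) n :
  exists k, (c *: mono hq N) ^+ n = k *: mono hq (N *+ n).
Proof.
elim: n => [|n [k IH]]; first by exists 1; rewrite expr0 mulr0n scale1r.
by rewrite exprS IH mulrS; apply: scale_monoM.
Qed.

(** Injectivity puts the terms of the exponential on distinct basis elements, so the series is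
    defined and each of its coefficients comes from a single term. *)
Lemma qexp_represents (p c : C) (N : mon) : injective (GRing.natmul N) ->
  represents (qexp p (c *: mono hq N)) 1%g (GRing.natmul N)
    (fun n => qexp_coef p n *: (c *: mono hq N) ^+ n).
Proof.
move=> Ninj; set x := c *: _.
pose term n : Q := (\prod_(1 <= i < n.+1) (1 - p ^+ i))^-1 *: (- x) ^+ n.
have termE n : term n = qexp_coef p n *: x ^+ n.
  by rewrite /term -scaleN1r exprZn scalerA.
have xE n : exists k, qexp_coef p n *: x ^+ n = k *: mono hq (N *+ n).
  have [k ->] := scale_monoX c N n; exists (qexp_coef p n * k).
  by rewrite scalerA.
have supp n M : (term n)@_M != 0 -> M = N *+ n.
  rewrite termE; have [k ->] := xE n; rewrite mcoeff_mono.
  by case: (N *+ n =P M) => [->|_] //; rewrite eqxx.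
pose f e := \sum_(n \in [set: nat]) skew_coef (1%g : G, term n) e.
have fE n : f (1%g, N *+ n) = (term n)@_(N *+ n).
  rewrite /f (fsbigE [:: n]) //= => [|i _]; last first.
    rewrite inE /skew_coef /= eqxx; apply: contraNeq => /supp /Ninj ->.
    by rewrite eqxx.
  by rewrite big_cons big_nil mem_set // addr0 /skew_coef /= eqxx.
exists f; split=> [|n|e].
- rewrite /qexp -/x; case: asboolP => // -[] M.
  have [[n ->]|ne] := pselect (exists n, M = N *+ n).
    apply: (sub_finite_set (B := [set n]%classic)); last exact: finite_set1.
    by move=> i /= /supp /Ninj.
  apply: (sub_finite_set (B := set0)) => [i /= /supp Mi|].
    by apply: ne; exists i.
  exact: finite_set0.
- rewrite fE termE; have [k ->] := xE n; rewrite mcoeff_mono eqxx.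
  by [].
- move=> fe; apply: contrapT => ne; move: fe; rewrite /f fsbig1 ?eqxx // => n _.
  apply: contrapT => /eqP; rewrite /skew_coef /=.
  case: (1%g =P e.1) => [g1|_]; last first.
    by rewrite eqxx.
  move=> /supp eN; apply: ne; exists n; case: e g1 eN => ? ? /= <- -> //.
Qed.

Lemma sgroupE (g : G) : exists f, [/\ sgroup g = Some f, f (g, 0) = 1 &
  forall e, f e != 0 -> e = (g, 0)].
Proof.
exists (fun e => (e == (g, 0))%:R); split=> //; first by rewrite eqxx.
by move=> e; case: (e =P _) => // _; rewrite eqxx.
Qed.

Lemma skew_mul1 (g : G) (x : Q) : skew_mul (g, x) (1%g, 1) = (g, x).
Proof. by rewrite /skew_mul /= mulg1 invg1 mulr1. Qed.

Lemma skew_mul1l (x y : Q) :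
  skew_mul (1%g, x) (1%g, y) = (1%g : G, x * y).
Proof. by rewrite /skew_mul /= mulg1 invg1. Qed.

Lemma skew_mulg (g : G) (x : Q) : skew_mul (g, mono hq 0) (1%g, x) = (g, x).
Proof. by rewrite /skew_mul /= mulg1 invg1 /= mono0 mul1r. Qed.

Lemma qexp2_represents (p p' : C) (g : G) (N N' : mon) (x x' : Q) r r' :
  injective (fun i : nat * nat => N *+ i.1 + N' *+ i.2) ->
  represents r 1%g (GRing.natmul N) (fun n => qexp_coef p n *: x ^+ n) ->
  represents r' 1%g (GRing.natmul N') (fun n => qexp_coef p' n *: x' ^+ n) ->
  represents (sprod [:: sgroup g; r; r']) g
    (fun i => N *+ i.1 + N' *+ i.2) (qexp_fam p p' x x').
Proof.
move=> Einj [f1 [-> f1E f1s]] [f2 [-> f2E f2s]].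
have [f0 [-> f0E f0s]] := sgroupE g.
have zipE (t0 t1 t2 : T) : \prod_(ft <- zip [:: f0; f1; f2] [:: t0; t1; t2])
    ft.1 ft.2 = f0 t0 * f1 t1 * f2 t2.
  by rewrite /= !big_cons big_nil /= mulr1 mulrA.
pose cov (i : nat * nat) : seq (seq T) :=
  [:: [:: (g, 0); (1%g, N *+ i.1); (1%g, N' *+ i.2)]].
have foldE i j : basis_prod [:: (g, 0); (1%g, N *+ i); (1%g, N' *+ j)] =
    (g, mono hq (N *+ i) * mono hq (N' *+ j)).
  by rewrite /basis_prod /= skew_mul1 skew_mul1l skew_mulg.
have [||t|S [SE Sv Ss]] := @sprod_cover [:: f0; f1; f2] _ g _ cov Einj.
- by [].
- move=> i t; rewrite inE => /eqP ->; split=> //; rewrite foldE.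
  have [k] := scale_monoM 1 1 (N *+ i.1) (N' *+ i.2).
  by rewrite !scale1r => ->; exists k.
- case: t => [|t0 [|t1 [|t2 []]]] // _.
  rewrite zipE !mulf_eq0 !negb_or -andbA.
  move=> /and3P[/f0s -> /f1s[i ->] /f2s[j ->]].
  by exists (i, j); rewrite inE.
exists S; split=> // i.
rewrite Sv /cov big_seq1 zipE foldE f0E mul1r /qexp_fam -f1E -f2E.
by rewrite -scalerAl -scalerAr scalerA.
Qed.

(** Brings a factor with a single exponential into the shape of two families, the second one
    evaluated at 0. *)
Lemma qexp1_represents (p p' : C) (g : G) (N N' : mon) (x : Q) r :
  injective (fun i : nat * nat => N *+ i.1 + N' *+ i.2) ->
  represents r 1%g (GRing.natmul N) (fun n => qexp_coef p n *: x ^+ n) ->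
  represents (sprod [:: sgroup g; r]) g
    (fun i => N *+ i.1 + N' *+ i.2) (qexp_fam p p' x 0).
Proof.
move=> Einj [f1 [-> f1E f1s]].
have [f0 [-> f0E f0s]] := sgroupE g.
have zipE (t0 t1 : T) : \prod_(ft <- zip [:: f0; f1] [:: t0; t1])
    ft.1 ft.2 = f0 t0 * f1 t1.
  by rewrite /= !big_cons big_nil /= mulr1.
(* As [0 ^+ n] is 1 for [n = 0] and 0 otherwise, only the indices with second component 0 receive a
   contribution. *)
pose cov (i : nat * nat) : seq (seq T) :=
  if i.2 is 0%N then [:: [:: (g, 0); (1%g, N *+ i.1)]] else [::].
have foldE i : basis_prod [:: (g, 0); (1%g, N *+ i)] = (g, mono hq (N *+ i)).
  by rewrite /basis_prod /= skew_mul1 skew_mulg.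
have [||t|S [SE Sv Ss]] := @sprod_cover [:: f0; f1] _ g _ cov Einj.
- by case=> i [].
- case=> i [|//] t; rewrite inE => /eqP ->; split=> //; rewrite foldE.
  by exists 1; rewrite scale1r mulr0n addr0.
- case: t => [|t0 [|t1 []]] // _.
  rewrite zipE !mulf_eq0 !negb_or => /andP[/f0s -> /f1s[i ->]].
  by exists (i, 0%N); rewrite inE.
exists S; split=> // -[i [|j]]; rewrite Sv /cov /qexp_fam /=.
  rewrite big_seq1 zipE foldE f0E mul1r -f1E expr0 /qexp_coef qpoch0.
  by rewrite invr1 expr0 mulr1 scale1r mulr1.
by rewrite big_nil expr0n /= scaler0 mulr0.
Qed.

Definition quad : eqType :=
  ((nat * nat) * (nat * nat) * (nat * nat) * (nat * nat))%type.

(** Moving the group elements to the left applies to each monomial the inverses of those on its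
    right; [N1], [N2], [N3] are the exponents after this transport. [cov j] collects the index
    choices whose product lands on [E j]. *)
Lemma sprod4 (t1 t2 t3 t4 : triple) (r1 r2 r3 r4 : series hq)
    (M1 M2 M3 M4 N1 N2 N3 : nat * nat -> mon) (x1 x2 x3 x4 : nat * nat -> Q)
    (J : eqType) (E : J -> mon) (cov : J -> seq quad) :
  represents r1 (Ggen hq t1) M1 x1 -> represents r2 (Ggen hq t2) M2 x2 ->
  represents r3 (Ggen hq t3) M3 x3 -> represents r4 (Ggen hq t4) M4 x4 ->
  injective M1 -> injective M2 -> injective M3 -> injective M4 ->
  (forall i, F t4 (F t3 (F t2 (mono hq (M1 i)))) = mono hq (N1 i)) ->
  (forall i, F t4 (F t3 (mono hq (M2 i))) = mono hq (N2 i)) ->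
  (forall i, F t4 (mono hq (M3 i)) = mono hq (N3 i)) ->
  injective E -> (forall j, uniq (cov j)) ->
  (forall i, exists j, i \in cov j) ->
  (forall j i, i \in cov j ->
     N1 i.1.1.1 + N2 i.1.1.2 + N3 i.1.2 + M4 i.2 = E j) ->
  exists S, [/\ sprod [:: r1; r2; r3; r4] = Some S,
    forall j, S ((Ggen hq t1 * (Ggen hq t2 * (Ggen hq t3 * Ggen hq t4)))%g, E j)
                *: mono hq (E j) =
      \sum_(i <- cov j) F t4 (F t3 (F t2 (x1 i.1.1.1))) *
         F t4 (F t3 (x2 i.1.1.2)) * F t4 (x3 i.1.2) * x4 i.2 &
    forall e, S e != 0 -> exists j,
      e = ((Ggen hq t1 * (Ggen hq t2 * (Ggen hq t3 * Ggen hq t4)))%g, E j)].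
Proof.
move=> [f1 [-> f1E f1s]] [f2 [-> f2E f2s]] [f3 [-> f3E f3s]] [f4 [-> f4E f4s]].
move=> i1 i2 i3 i4 T1 T2 T3 Einj covU cov_all covE.
set g := (_ * _)%g.
pose tup (i : quad) : seq T := [:: (Ggen hq t1, M1 i.1.1.1);
  (Ggen hq t2, M2 i.1.1.2); (Ggen hq t3, M3 i.1.2); (Ggen hq t4, M4 i.2)].
have tup_inj : injective tup.
  move=> [[[a b] c] d] [[[a' b'] c'] d'].
  move=> /(congr1 (fun t => [seq u.2 | u <- t])) [].
  by move=> /i1 -> /i2 -> /i3 -> /i4 ->.
have zipE i : \prod_(ft <- zip [:: f1; f2; f3; f4] (tup i)) ft.1 ft.2 =
    f1 (Ggen hq t1, M1 i.1.1.1) * f2 (Ggen hq t2, M2 i.1.1.2) *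
    f3 (Ggen hq t3, M3 i.1.2) * f4 (Ggen hq t4, M4 i.2).
  by rewrite /= !big_cons big_nil /= mulr1 !mulrA.
(* The inverses in [skew_mul] become the maps [F] themselves, which are involutions. *)
have GV t : (Ggen hq t)^-1%g = Ggen hq t.
  apply/(mulIg (Ggen hq t)); rewrite mulVg; apply: G_eq => x /=.
  by rewrite F_involutive.
have foldE i : basis_prod (tup i) =
    (g, F t4 (F t3 (F t2 (mono hq (M1 i.1.1.1)))) *
        (F t4 (F t3 (mono hq (M2 i.1.1.2))) *
        (F t4 (mono hq (M3 i.1.2)) * mono hq (M4 i.2)))).
  rewrite /basis_prod /= skew_mul1 /skew_mul /= !invgM !GV /g.
  by [].
have [||t|S [SE Sv Ss]] := @sprod_cover [:: f1; f2; f3; f4] _ g _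
    (fun j => map tup (cov j)) Einj.
- by move=> j; rewrite map_inj_uniq.
- move=> j t /mapP[i ij ->]; split=> //; rewrite foldE T1 T2 T3 -(covE _ _ ij).
  have [c3 e3] := scale_monoM 1 1 (N3 i.1.2) (M4 i.2).
  have [c2 e2] := scale_monoM 1 c3 (N2 i.1.1.2) (N3 i.1.2 + M4 i.2).
  have [c1 e1] := scale_monoM 1 c2 (N1 i.1.1.1)
    (N2 i.1.1.2 + (N3 i.1.2 + M4 i.2)).
  by exists c1; rewrite -!addrA -e1 -e2 -e3 !scale1r.
- case: t => [|u1 [|u2 [|u3 [|u4 []]]]] // _.
  rewrite /= !big_cons big_nil /= mulr1 !mulf_eq0 !negb_or.
  move=> /and4P[/f1s[a ->] /f2s[b ->] /f3s[c ->] /f4s[d ->]].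
  have [j ij] := cov_all (a, b, c, d); exists j.
  by apply/mapP; exists (a, b, c, d).
exists S; split=> // j; rewrite Sv big_map; apply: eq_bigr => i _.
rewrite zipE foldE /= -f1E -f2E -f3E -f4E.
by rewrite !linearZ /= scale_mul4 !mulrA.
Qed.

End SeriesProducts.

(** * Monomials *)

(* F maps a's to a's and b's to b's, so no power of q appears in F(a^m b^n). *)
Definition Fmon (t : triple) (M : mon) : mon :=
  ([ffun x => if x == ti t then M.1 (ti t) + M.1 (tj t) - M.1 (tk t)
              else if x == tj t then M.1 (tk t)
              else if x == tk t then M.1 (tj t) else M.1 x],
   [ffun x => if x == tj t then M.2 (ti t) + M.2 (tk t)
              else if x == tk t then M.2 (tj t) - M.2 (ti t) else M.2 x]).

Definition triple_mon (t : triple) (al be de : int) : mon :=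
  ([ffun x => if x == ti t then al else if x == tj t then - al
              else if x == tk t then de else 0],
   [ffun x => if x == ti t then be else if x == tk t then - be else 0]).

Lemma FmonD t : {morph Fmon t : M N / M + N}.
Proof.
move=> M N; congr pair; apply/ffunP => x; rewrite !ffunE;
  do ?case: ifP => _; rewrite ?ffunE //; ring.
Qed.

Lemma triple_cases t (x : 'I_6) :
  [\/ x = ti t, x = tj t, x = tk t |
      [/\ (x == ti t) = false, (x == tj t) = false & (x == tk t) = false]].
Proof.
case: (x =P ti t) => [|_]; first by constructor 1.
case: (x =P tj t) => [|_]; first by constructor 2.
by case: (x =P tk t) => [|_]; [constructor 3|constructor 4].
Qed.

Lemma triple_eqs t :
  ((ti t == tj t) = false) * ((tj t == tk t) = false) *
  ((ti t == tk t) = false) * ((tj t == ti t) = false) *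
  ((tk t == tj t) = false) * ((tk t == ti t) = false).
Proof.
have [ij jk ik] := triple_neq t.
by rewrite ![_ == ti t]eq_sym (eq_sym (tk t)) !(negPf ij, negPf jk, negPf ik).
Qed.

Section Monomials.
Context (C : fieldType) (q : C) (hq : q != 0).
Local Notation Q := (qtorus hq).
Local Notation F := (@F C q hq).

Lemma delta_sum (m : {ffun 'I_6 -> int}) :
  m = \sum_i [ffun j => (j == i)%:R : int] *~ m i.
Proof.
apply/ffunP => k; rewrite sum_ffunE (bigD1 k) //= big1 ?addr0.
  by rewrite ffunMzE ffunE eqxx intz.
by move=> i; rewrite ffunMzE ffunE eq_sym => /negPf->; rewrite mul0rz.
Qed.

(** Every exponent vector is an integer combination of unit vectors, so a map from sums to products
    of units is determined by its values on them. *)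
Lemma morph_ffun_ext (e e' : {ffun 'I_6 -> int} -> Q) :
  {morph e : m n / m + n >-> m * n} -> (forall m, e m \is a GRing.unit) ->
  {morph e' : m n / m + n >-> m * n} -> (forall m, e' m \is a GRing.unit) ->
  (forall i, e [ffun j => (j == i)%:R] = e' [ffun j => (j == i)%:R]) -> e =1 e'.
Proof.
move=> eD eU eD' eU' ee m; rewrite (delta_sum m).
have [e0 _ eX] := mono_exp eD eU; have [e0' _ eX'] := mono_exp eD' eU'.
rewrite (big_morph e eD e0) (big_morph e' eD' e0').
by apply: eq_bigr => i _; rewrite eX eX' ee.
Qed.

(** On pure [a]-monomials and on pure [b]-monomials both sides are multiplicative, so the generators
    suffice; a general monomial is a product of the two kinds. *)
Lemma F_mono t M : F t (mono hq M) = mono hq (Fmon t M).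
Proof.
have FU x : x \is a GRing.unit -> F t x \is a GRing.unit.
  exact: (rmorph_unit (F t)).
have E := (eqxx, triple_eqs t).
have Fa m : F t (mono hq (amon m)) = mono hq (Fmon t (amon m)).
  pose f m := (Fmon t (amon m)).1.
  have fE m' : Fmon t (amon m') = amon (f m').
    congr pair; apply/ffunP => x; rewrite !ffunE.
    by do ?case: ifP => _; rewrite ?addr0 ?subr0.
  rewrite fE.
  apply: (morph_ffun_ext (e := fun m => F t (mono hq (amon m)))
    (e' := fun m => mono hq (amon (f m)))) => {m} [m n|m|m n|m|i].
  - by rewrite mono_aD rmorphM.
  - exact/FU/mono_unit.
  - rewrite -mono_aD; congr (mono hq (amon _)); rewrite /f.
    have -> : amon (m + n) = amon m + amon n.
      by rewrite /amon; congr pair; rewrite addr0.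
    by rewrite FmonD.
  - exact: mono_unit.
  rewrite F_a /Fa.
  have [_ aN _] := mono_exp (mono_aD hq) (fun m => mono_unit hq (amon m)).
  rewrite -aN -!mono_aD; case: ifP => [/eqP ->|ij'];
    last case: ifP => [/eqP ->|ik'].
  - congr (mono hq (amon _)); apply/ffunP => x.
    by have [->|->|->|[x1 x2 x3]] := triple_cases t x;
      rewrite !ffunE ?E ?x1 ?x2 ?x3.
  - congr (mono hq (amon _)); apply/ffunP => x.
    by have [->|->|->|[x1 x2 x3]] := triple_cases t x;
      rewrite !ffunE ?E ?x1 ?x2 ?x3.
  - have [i1|/negbTE i1] := eqVneq i (ti t).
      subst i; congr (mono hq (amon _)); apply/ffunP => x.
      by have [->|->|->|[x1 x2 x3]] := triple_cases t x;
        rewrite !ffunE ?E ?x1 ?x2 ?x3.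
    congr (mono hq (amon _)); apply/ffunP => x.
    have [->|->|->|[x1 x2 x3]] := triple_cases t x;
      by rewrite !ffunE ?E ?x1 ?x2 ?x3 // ?[_ == i]eq_sym ?i1 ?ij' ?ik'.
have Fb m : F t (mono hq (bmon m)) = mono hq (Fmon t (bmon m)).
  pose f m := (Fmon t (bmon m)).2.
  have fE m' : Fmon t (bmon m') = bmon (f m').
    congr pair; apply/ffunP => x; rewrite !ffunE.
    by do ?case: ifP => _; rewrite ?addr0 ?subr0.
  rewrite fE.
  apply: (morph_ffun_ext (e := fun m => F t (mono hq (bmon m)))
    (e' := fun m => mono hq (bmon (f m)))) => {m} [m n|m|m n|m|i].
  - by rewrite mono_bD rmorphM.
  - exact/FU/mono_unit.
  - rewrite -mono_bD; congr (mono hq (bmon _)); rewrite /f.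
    have -> : bmon (m + n) = bmon m + bmon n.
      by rewrite /bmon; congr pair; rewrite addr0.
    by rewrite FmonD.
  - exact: mono_unit.
  rewrite F_b /Fb.
  have [_ bN _] := mono_exp (mono_bD hq) (fun m => mono_unit hq (bmon m)).
  rewrite -bN -!mono_bD; case: ifP => [/eqP ->|ii'];
    last case: ifP => [/eqP ->|ij']; last case: ifP => [/eqP ->|ik'].
  - congr (mono hq (bmon _)); apply/ffunP => x.
    by have [->|->|->|[x1 x2 x3]] := triple_cases t x;
      rewrite !ffunE ?E ?x1 ?x2 ?x3.
  - congr (mono hq (bmon _)); apply/ffunP => x.
    by have [->|->|->|[x1 x2 x3]] := triple_cases t x;
      rewrite !ffunE ?E ?x1 ?x2 ?x3.
  - congr (mono hq (bmon _)); apply/ffunP => x.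
    by have [->|->|->|[x1 x2 x3]] := triple_cases t x;
      rewrite !ffunE ?E ?x1 ?x2 ?x3.
  - congr (mono hq (bmon _)); apply/ffunP => x.
    have [->|->|->|[x1 x2 x3]] := triple_cases t x;
      by rewrite !ffunE ?E ?x1 ?x2 ?x3 // ?[_ == i]eq_sym ?ii' ?ij' ?ik'.
case: M => m n; rewrite -mono_ab rmorphM /= Fa Fb.
have -> : (m, n) = amon m + bmon n.
  by rewrite /amon /bmon; congr pair; rewrite ?addr0 ?add0r.
rewrite FmonD monoM.
(* The two images involve only [a]'s and only [b]'s and are multiplied in the standard order, so no
   power of [q] arises. *)
have -> : pairing (Fmon t (amon m)) (Fmon t (bmon n)) = 0;
  last by rewrite oppr0 scale1r.
apply: big1 => x _; rewrite !ffunE.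
by do ?case: ifP => _; rewrite ?addr0 ?subr0 ?mul0r.
Qed.

Lemma agenX i z : agen hq i ^ z = mono hq (amon ([ffun j => (j == i)%:R] *~ z)).
Proof.
have aX m z' : mono hq (amon (m *~ z')) = mono hq (amon m) ^ z'.
  by case: (mono_exp (mono_aD hq) (fun m => mono_unit hq (amon m))) => _ _ ->.
rewrite aX.
congr (_ ^ _).
Qed.
Lemma bgenX i z : bgen hq i ^ z = mono hq (bmon ([ffun j => (j == i)%:R] *~ z)).
Proof.
have aX m z' : mono hq (bmon (m *~ z')) = mono hq (bmon m) ^ z'.
  by case: (mono_exp (mono_bD hq) (fun m => mono_unit hq (bmon m))) => _ _ ->.
rewrite aX.
congr (_ ^ _).
Qed.

Lemma triple_mono t (al be de : int) :
  agen hq (ti t) ^ al * agen hq (tj t) ^ (- al) * agen hq (tk t) ^ de *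
  bgen hq (ti t) ^ be * bgen hq (tk t) ^ (- be) =
  mono hq (triple_mon t al be de).
Proof.
pose d i : {ffun 'I_6 -> int} := [ffun j => (j == i)%:R].
have hA : agen hq (ti t) ^ al * agen hq (tj t) ^ (- al) * agen hq (tk t) ^ de =
    mono hq (amon (d (ti t) *~ al + d (tj t) *~ (- al) + d (tk t) *~ de)).
  by rewrite !agenX !mono_aD.
have hB : bgen hq (ti t) ^ be * bgen hq (tk t) ^ (- be) =
    mono hq (bmon (d (ti t) *~ be + d (tk t) *~ (- be))).
  by rewrite !bgenX mono_bD.
rewrite -[LHS]mulrA hA hB mono_ab {hA hB}.
have E := (eqxx, triple_eqs t).
apply: congr1; congr pair; apply/ffunP => x; rewrite !ffunE !ffunMzE !ffunE.
  by have [->|->|->|[x1 x2 x3]] := triple_cases t x;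
    rewrite ?E ?x1 ?x2 ?x3 ?mul0rz ?intz ?addr0 ?add0r.
by have [->|->|->|[x1 x2 x3]] := triple_cases t x;
  rewrite ?E ?x1 ?x2 ?x3 ?mul0rz ?intz ?addr0 ?add0r.
Qed.

End Monomials.

(** Explicit coordinates reduce identities between exponents to integer identities for [ring]. *)
Definition mk_mon (a1 a2 a3 a4 a5 a6 b1 b2 b3 b4 b5 b6 : int) : mon :=
  ([ffun x : 'I_6 => nth 0 [:: a1; a2; a3; a4; a5; a6] x],
   [ffun x : 'I_6 => nth 0 [:: b1; b2; b3; b4; b5; b6] x]).

Lemma mk_monD a1 a2 a3 a4 a5 a6 b1 b2 b3 b4 b5 b6
    a1' a2' a3' a4' a5' a6' b1' b2' b3' b4' b5' b6' :
  mk_mon a1 a2 a3 a4 a5 a6 b1 b2 b3 b4 b5 b6 +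
  mk_mon a1' a2' a3' a4' a5' a6' b1' b2' b3' b4' b5' b6' =
  mk_mon (a1 + a1') (a2 + a2') (a3 + a3') (a4 + a4') (a5 + a5') (a6 + a6')
         (b1 + b1') (b2 + b2') (b3 + b3') (b4 + b4') (b5 + b5') (b6 + b6').
Proof.
by congr pair; apply/ffunP => -[[|[|[|[|[|[|//]]]]]] Hx]; rewrite !ffunE.
Qed.

Lemma pairing_mk a1 a2 a3 a4 a5 a6 b1 b2 b3 b4 b5 b6
    a1' a2' a3' a4' a5' a6' b1' b2' b3' b4' b5' b6' :
  pairing (mk_mon a1 a2 a3 a4 a5 a6 b1 b2 b3 b4 b5 b6)
    (mk_mon a1' a2' a3' a4' a5' a6' b1' b2' b3' b4' b5' b6') =
  b1 * a1' + b2 * a2' + b3 * a3' + b4 * a4' + b5 * a5' + b6 * a6'.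
Proof. by rewrite /pairing !big_ord_recl big_ord0 !ffunE /= addr0 !addrA. Qed.

Lemma Fmon_mk123 a1 a2 a3 a4 a5 a6 b1 b2 b3 b4 b5 b6 :
  Fmon t123 (mk_mon a1 a2 a3 a4 a5 a6 b1 b2 b3 b4 b5 b6) =
  mk_mon (a1 + a2 - a3) a3 a2 a4 a5 a6 b1 (b1 + b3) (b2 - b1) b4 b5 b6.
Proof.
by congr pair; apply/ffunP => -[[|[|[|[|[|[|//]]]]]] Hx];
  rewrite !ffunE -!val_eqE.
Qed.

Lemma Fmon_mk145 a1 a2 a3 a4 a5 a6 b1 b2 b3 b4 b5 b6 :
  Fmon t145 (mk_mon a1 a2 a3 a4 a5 a6 b1 b2 b3 b4 b5 b6) =
  mk_mon (a1 + a4 - a5) a2 a3 a5 a4 a6 b1 b2 b3 (b1 + b5) (b4 - b1) b6.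
Proof.
by congr pair; apply/ffunP => -[[|[|[|[|[|[|//]]]]]] Hx];
  rewrite !ffunE -!val_eqE.
Qed.

Lemma Fmon_mk246 a1 a2 a3 a4 a5 a6 b1 b2 b3 b4 b5 b6 :
  Fmon t246 (mk_mon a1 a2 a3 a4 a5 a6 b1 b2 b3 b4 b5 b6) =
  mk_mon a1 (a2 + a4 - a6) a3 a6 a5 a4 b1 b2 b3 (b2 + b6) b5 (b4 - b2).
Proof.
by congr pair; apply/ffunP => -[[|[|[|[|[|[|//]]]]]] Hx];
  rewrite !ffunE -!val_eqE.
Qed.

Lemma Fmon_mk356 a1 a2 a3 a4 a5 a6 b1 b2 b3 b4 b5 b6 :
  Fmon t356 (mk_mon a1 a2 a3 a4 a5 a6 b1 b2 b3 b4 b5 b6) =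
  mk_mon a1 a2 (a3 + a5 - a6) a4 a6 a5 b1 b2 b3 b4 (b3 + b6) (b5 - b3).
Proof.
by congr pair; apply/ffunP => -[[|[|[|[|[|[|//]]]]]] Hx];
  rewrite !ffunE -!val_eqE.
Qed.

Definition Fmon_mk := (Fmon_mk123, Fmon_mk145, Fmon_mk246, Fmon_mk356).

Lemma triple_mon123 al be de : triple_mon t123 al be de =
  mk_mon al (- al) de 0 0 0 be 0 (- be) 0 0 0.
Proof.
by congr pair; apply/ffunP => -[[|[|[|[|[|[|//]]]]]] Hx];
  rewrite !ffunE -!val_eqE.
Qed.

Lemma triple_mon145 al be de : triple_mon t145 al be de =
  mk_mon al 0 0 (- al) de 0 be 0 0 0 (- be) 0.
Proof.
by congr pair; apply/ffunP => -[[|[|[|[|[|[|//]]]]]] Hx];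
  rewrite !ffunE -!val_eqE.
Qed.

Lemma triple_mon246 al be de : triple_mon t246 al be de =
  mk_mon 0 al 0 (- al) 0 de 0 be 0 0 0 (- be).
Proof.
by congr pair; apply/ffunP => -[[|[|[|[|[|[|//]]]]]] Hx];
  rewrite !ffunE -!val_eqE.
Qed.

Lemma triple_mon356 al be de : triple_mon t356 al be de =
  mk_mon 0 0 al 0 (- al) de 0 0 be 0 0 (- be).
Proof.
by congr pair; apply/ffunP => -[[|[|[|[|[|[|//]]]]]] Hx];
  rewrite !ffunE -!val_eqE.
Qed.

Definition triple_monE :=
  (triple_mon123, triple_mon145, triple_mon246, triple_mon356).

(* The exponents of w = F356(x246). *)
Definition wmon (al be de : int) : mon :=
  mk_mon 0 al (- de) (- al) de 0 0 be 0 0 (- be) 0.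

(** * Exponents of the transported monomials; the primed lemmas belong to the right side of the
    equation *)

Section Twists.
Context (al be de : int).

Lemma Fmon_123 :
  Fmon t356 (Fmon t246 (Fmon t145 (triple_mon t123 al be de))) =
  triple_mon t123 al be de.
Proof. by rewrite !triple_monE !Fmon_mk; congr mk_mon; ring. Qed.

Lemma Fmon_145 : Fmon t356 (Fmon t246 (triple_mon t145 al be de)) =
  triple_mon t123 al be de + triple_mon t356 al be de.
Proof. by rewrite !triple_monE !Fmon_mk mk_monD; congr mk_mon; ring. Qed.

Lemma Fmon_246 : Fmon t356 (triple_mon t246 al be de) = wmon al be de.
Proof. by rewrite !triple_monE !Fmon_mk; congr mk_mon; ring. Qed.

Lemma Fmon_356' : Fmon t123 (Fmon t145 (Fmon t246 (triple_mon t356 al be de))) =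
  wmon al be de.
Proof. by rewrite !triple_monE !Fmon_mk; congr mk_mon; ring. Qed.

Lemma Fmon_246' : Fmon t123 (Fmon t145 (triple_mon t246 al be de)) =
  triple_mon t356 al be de.
Proof. by rewrite !triple_monE !Fmon_mk; congr mk_mon; ring. Qed.

Lemma Fmon_145' : Fmon t123 (triple_mon t145 al be de) =
  wmon al be de + triple_mon t123 al be de.
Proof. by rewrite !triple_monE !Fmon_mk mk_monD; congr mk_mon; ring. Qed.

End Twists.

Section Pairings.
Context (al be de al' be' de' : int).
Local Notation u := (triple_mon t123 al be de).
Local Notation v := (triple_mon t356 al be de).
Local Notation w := (wmon al be de).
Local Notation u' := (triple_mon t123 al' be' de').
Local Notation v' := (triple_mon t356 al' be' de').
Local Notation w' := (wmon al' be' de').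

(** With equal parameter triples these pairings give the q-commutation within one family, with
    different ones the commutation between the two families. *)
Lemma pairing_uu : pairing u u' = be * al' - be * de'.
Proof. by rewrite ?triple_monE pairing_mk; ring. Qed.
Lemma pairing_uv : pairing u v' = - (be * al').
Proof. by rewrite ?triple_monE pairing_mk; ring. Qed.
Lemma pairing_uw : pairing u w' = be * de'.
Proof. by rewrite ?triple_monE pairing_mk; ring. Qed.
Lemma pairing_vu : pairing v u' = be * de'.
Proof. by rewrite ?triple_monE pairing_mk; ring. Qed.
Lemma pairing_vv : pairing v v' = be * al' - be * de'.
Proof. by rewrite ?triple_monE pairing_mk; ring. Qed.
Lemma pairing_vw : pairing v w' = - (be * de').
Proof. by rewrite ?triple_monE pairing_mk; ring. Qed.
Lemma pairing_wu : pairing w u' = - (be * al').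
Proof. by rewrite ?triple_monE pairing_mk; ring. Qed.
Lemma pairing_wv : pairing w v' = be * al'.
Proof. by rewrite ?triple_monE pairing_mk; ring. Qed.
Lemma pairing_ww : pairing w w' = be * al' - be * de'.
Proof. by rewrite ?triple_monE pairing_mk; ring. Qed.

End Pairings.

Definition pairingE := (pairing_uu, pairing_uv, pairing_uw,
  pairing_vu, pairing_vv, pairing_vw,
  pairing_wu, pairing_wv, pairing_ww).

Lemma linear_mono_ext (C : fieldType) (q : C) (hq : q != 0)
    (f g : {linear qtorus hq -> qtorus hq}) :
  (forall M, f (mono hq M) = g (mono hq M)) -> f =1 g.
Proof.
move=> fg x; rewrite [x]monoE [LHS]linear_sum [RHS]linear_sum.
by apply: eq_bigr => M _ /=; rewrite [LHS]linearZ [RHS]linearZ /= fg.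
Qed.

(** Both compositions are linear and permute the basis monomials, so it is enough to compare twelve
    exponents. *)
Lemma tetrahedron_G (C : fieldType) (q : C) (hq : q != 0) :
  (Ggen hq t123 * (Ggen hq t145 * (Ggen hq t246 * Ggen hq t356)))%g =
  (Ggen hq t356 * (Ggen hq t246 * (Ggen hq t145 * Ggen hq t123)))%g.
Proof.
pose f t1 t2 t3 t4 : {linear qtorus hq -> qtorus hq} :=
  F (hq := hq) t1 \o (F (hq := hq) t2 \o (F (hq := hq) t3 \o F (hq := hq) t4)).
apply: G_eq; apply: (linear_mono_ext (f := f t123 t145 t246 t356)
  (g := f t356 t246 t145 t123)) => M /=.
rewrite !F_mono; apply: congr1.
have -> : M = mk_mon (M.1 (lab 1)) (M.1 (lab 2)) (M.1 (lab 3)) (M.1 (lab 4))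
    (M.1 (lab 5)) (M.1 (lab 6)) (M.2 (lab 1)) (M.2 (lab 2)) (M.2 (lab 3))
    (M.2 (lab 4)) (M.2 (lab 5)) (M.2 (lab 6)).
  case: M => m n; congr pair; apply/ffunP => -[[|[|[|[|[|[|//]]]]]] Hx];
    by rewrite !ffunE /=; congr (_ _); apply: val_inj.
by rewrite !Fmon_mk; congr mk_mon; ring.
Qed.

Lemma monMn1 (M : mon) n x : (M *+ n).1 x = M.1 x *+ n.
Proof. by elim: n => [|n IH]; rewrite ?mulr0n ?mulrS !ffunE ?IH. Qed.

Lemma monMn2 (M : mon) n x : (M *+ n).2 x = M.2 x *+ n.
Proof. by elim: n => [|n IH]; rewrite ?mulr0n ?mulrS !ffunE ?IH. Qed.

(** * Linear independence of the exponents *)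

Section Independence.
Context (al be de al' be' de' : int) (m m' : nat).
Hypothesis h1 : al * be' + de' * be = 0.
Hypotheses (nz : (al + de) * be != 0) (nz' : (al' + de') * be' != 0).
Hypotheses (m0 : (0 < m)%N) (m0' : (0 < m')%N).

(** By [h1] the determinant [al * be' - al' * be] equals [- ((al' + de') * be)], which is nonzero by
    [nz] and [nz']. *)
Lemma exponents_inj (a a' b b' : nat) :
  al *+ m *+ a + al' *+ m' *+ a' = al *+ m *+ b + al' *+ m' *+ b' ->
  be *+ m *+ a + be' *+ m' *+ a' = be *+ m *+ b + be' *+ m' *+ b' ->
  a = b /\ a' = b'.
Proof.
have E (x : int) k n : x *+ k *+ n = x * (k%:R * n%:R).
  by rewrite -mulrnA -natrM mulr_natr.
rewrite !{}E => ea eb.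
pose X : int := m%:R * (a%:R - b%:R); pose X' : int := m'%:R * (a'%:R - b'%:R).
have {}ea : al * X + al' * X' = 0 by rewrite /X /X'; lra.
have {}eb : be * X + be' * X' = 0 by rewrite /X /X'; lra.
have X'0 : X' = 0.
  apply: (mulfI nz'); rewrite mulr0.
  (* In this combination the terms in [X] cancel and [(al' + de') * be' * X'] remains. *)
  transitivity (be' * (al * X + al' * X') + de' * (be * X + be' * X') -
    X * (al * be' + de' * be)); first by ring.
  by rewrite ea eb h1; ring.
have be0 : be != 0 by move: nz; rewrite mulf_eq0 negb_or => /andP[].
have X0 : X = 0.
  by apply: (mulfI be0); rewrite mulr0; move: eb; rewrite X'0 mulr0 addr0.
have nat_eq (k x y : nat) :
    (0 < k)%N -> k%:R * (x%:R - y%:R) = 0 :> int -> x = y.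
  move=> k0 /eqP; rewrite mulf_eq0 pnatr_eq0 eqn0Ngt k0 /= subr_eq0 eqr_nat.
  by move=> /eqP.
by split; [exact: nat_eq m0 X0 | exact: nat_eq m0' X'0].
Qed.

End Independence.

Definition mon_fam (M M' : mon) (i : nat * nat) : mon := M *+ i.1 + M' *+ i.2.

Lemma mon_fam_sub M M' A i : (i.1 <= A.1)%N -> (i.2 <= A.2)%N ->
  mon_fam M M' (sub2 A i) + mon_fam M M' i = mon_fam M M' A.
Proof.
by move=> h h'; rewrite /mon_fam /sub2 /= addrACA -!mulrnDr !subnK.
Qed.

Lemma mon_famD M M' N N' i :
  mon_fam (M + N) (M' + N') i = mon_fam M M' i + mon_fam N N' i.
Proof. by rewrite /mon_fam !mulrnDl addrACA. Qed.

Lemma Fmon0 t : Fmon t 0 = 0.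
Proof. by apply: (addIr (Fmon t 0)); rewrite -FmonD !add0r. Qed.

Lemma FmonMn t M n : Fmon t (M *+ n) = Fmon t M *+ n.
Proof.
by elim: n => [|n IH]; rewrite ?mulr0n ?Fmon0 // !mulrS FmonD IH.
Qed.

Lemma Fmon_fam t M M' i :
  Fmon t (mon_fam M M' i) = mon_fam (Fmon t M) (Fmon t M') i.
Proof. by rewrite /mon_fam FmonD !FmonMn. Qed.

Section Powers.
Context (C : fieldType) (A : algType C).
Implicit Types (u v : A).

Lemma scaleX_qcomm (Q c d : C) u v m : v * u = Q *: (u * v) ->
  (d *: v ^+ m) * (c *: u ^+ m) =
  Q ^+ (m ^ 2) *: ((c *: u ^+ m) * (d *: v ^+ m)).
Proof.
move=> vu; rewrite -!scalerAl -!scalerAr (qcommX _ _ vu) !scalerA mulnn.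
by congr (_ *: _); ring.
Qed.

(** This explains the factor $Q^{m(m-1)/2}$ in the theorem: the power of [Q] from reordering
    [(u * v) ^+ m] supplies the second copy of it. *)
Lemma scaleXM_qcomm (Q c d : C) u v m : v * u = Q *: (u * v) ->
  (Q ^+ 'C(m, 2) * (c * d)) *: (u * v) ^+ m =
  (Q ^+ 'C(m, 2) * c *: u ^+ m) * (Q ^+ 'C(m, 2) * d *: v ^+ m).
Proof.
move=> vu; rewrite -!scalerAl -!scalerAr (exprM_qcomm _ vu) !scalerA.
by congr (_ *: _); ring.
Qed.

End Powers.

Section Family.
Context (C : fieldType) (q : C) (hq : q != 0) (al be de : int).
Local Notation F := (@F C q hq).

(** The prefactor is chosen so that the image of the generator for 145 is exactly a product of two
    generators, as in [F_gen145] and [F_gen145']: reordering that product yields [q ^ (al * be)],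
    which absorbs one of its two prefactors. *)
Definition triple_gen t := q ^ (- (al * be)) *: mono hq (triple_mon t al be de).
Definition wgen := q ^ (- (al * be)) *: mono hq (wmon al be de).

Local Notation Q := (q ^ (- ((al + de) * be))).

Lemma F_scale t c M : F t (c *: mono hq M) = c *: mono hq (Fmon t M).
Proof. by rewrite linearZ /= F_mono. Qed.

(** Monomials q-commute, with exponent the antisymmetrized [pairing]. *)
Lemma scale_mono_qcomm (c d : C) (M N : mon) (z : int) :
  pairing M N = pairing N M + z ->
  (d *: mono hq N) * (c *: mono hq M) =
  q ^ z *: ((c *: mono hq M) * (d *: mono hq N)).
Proof.
move=> e; rewrite -!scalerAl -!scalerAr !monoM !scalerA (addrC N M) e.
rewrite opprD expfzDr // mulrC.
have -> : q ^ (- z) = (q ^ z)^-1 by rewrite -invr_expz.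
congr (_ *: _); have qz : q ^ z != 0 by rewrite expfz_neq0.
by field.
Qed.

Lemma vu_qcomm : triple_gen t356 * triple_gen t123 =
  Q *: (triple_gen t123 * triple_gen t356).
Proof. by apply: scale_mono_qcomm; rewrite !pairingE; ring. Qed.

Lemma uw_qcomm : triple_gen t123 * wgen = Q *: (wgen * triple_gen t123).
Proof. by apply: scale_mono_qcomm; rewrite !pairingE; ring. Qed.

Lemma wv_qcomm : wgen * triple_gen t356 = Q *: (triple_gen t356 * wgen).
Proof. by apply: scale_mono_qcomm; rewrite !pairingE; ring. Qed.

Lemma F_gen123 : F t356 (F t246 (F t145 (triple_gen t123))) = triple_gen t123.
Proof. by rewrite !F_scale Fmon_123. Qed.

Lemma F_gen145 : F t356 (F t246 (triple_gen t145)) =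
  triple_gen t123 * triple_gen t356.
Proof.
rewrite !F_scale Fmon_145 -scalerAl -scalerAr monoM !scalerA pairingE.
congr (_ *: _); rewrite opprK -mulrA [be * al]mulrC -expfzDr //.
by rewrite addNr mulr1.
Qed.

Lemma F_gen246 : F t356 (triple_gen t246) = wgen.
Proof. by rewrite !F_scale Fmon_246. Qed.

Lemma F_gen356' : F t123 (F t145 (F t246 (triple_gen t356))) = wgen.
Proof. by rewrite !F_scale Fmon_356'. Qed.

Lemma F_gen246' : F t123 (F t145 (triple_gen t246)) = triple_gen t356.
Proof. by rewrite !F_scale Fmon_246'. Qed.

Lemma F_gen145' : F t123 (triple_gen t145) = wgen * triple_gen t123.
Proof.
rewrite !F_scale Fmon_145' -scalerAl -scalerAr monoM !scalerA pairingE.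
congr (_ *: _); rewrite opprK -mulrA [be * al]mulrC -expfzDr //.
by rewrite addNr mulr1.
Qed.

End Family.

Section Exponents.
Context (al be de al' be' de' : int) (m m' : nat).
Hypotheses (h1 : al * be' + de' * be = 0) (h2 : al' * be + de * be' = 0).
Hypotheses (nz : (al + de) * be != 0) (nz' : (al' + de') * be' != 0).
Hypotheses (m0 : (0 < m)%N) (m0' : (0 < m')%N).

Definition triple_fam t :=
  mon_fam (triple_mon t al be de *+ m) (triple_mon t al' be' de' *+ m').
Definition wfam := mon_fam (wmon al be de *+ m) (wmon al' be' de' *+ m').

(** The basis monomials of both sides, indexed by their total degrees in [u], [v] and [w], each a
    pair. *)
Definition tetra_fam (j : (nat * nat) * (nat * nat) * (nat * nat)) : mon :=
  triple_fam t123 j.1.1 + triple_fam t356 j.1.2 + wfam j.2.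

Lemma triple_fam_inj t : injective (triple_fam t).
Proof.
move=> [a a'] [b b'] e.
have := congr1 (fun M : mon => M.1 (ti t)) e.
have := congr1 (fun M : mon => M.2 (ti t)) e.
rewrite /triple_fam /mon_fam !ffunE !monMn1 !monMn2 !ffunE eqxx /= => eb ea.
by have [-> ->] := exponents_inj h1 nz nz' m0 m0' ea eb.
Qed.

(** The exponents of $a_1, b_1$ see only [u], those of $a_4, b_2$ only [w], and those of $a_6, b_6$
    only [v]; [exponents_inj] recovers each pair of degrees. *)
Lemma tetra_fam_inj : injective tetra_fam.
Proof.
move=> [[[a a'] [b b']] [c c']] [[[a0 a0'] [b0 b0']] [c0 c0']] e.
have coords x :=
  (congr1 (fun M : mon => M.1 x) e, congr1 (fun M : mon => M.2 x) e).
have [a1 b1] := coords (lab 1).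
have [a4 _] := coords (lab 4).
have [_ b2] := coords (lab 2).
have [a6 b6] := coords (lab 6).
move: a1 b1 a4 b2 a6 b6.
rewrite /tetra_fam /triple_fam /wfam /mon_fam !triple_monE.
rewrite !ffunE !monMn1 !monMn2 !ffunE /= !mul0rn !addr0 !add0r.
move=> a1 b1 a4 b2 a6 b6.
have [-> ->] := exponents_inj h1 nz nz' m0 m0' a1 b1.
have [|||-> ->] := exponents_inj (de := - de) (de' := - de') _ _ _ m0 m0' a4 b2.
- by rewrite !mulNr -opprD h1 oppr0.
- by rewrite -opprD mulNr oppr_eq0.
- by rewrite -opprD mulNr oppr_eq0.
(* Here [al] and [de] change roles and [be] changes sign, so the relation required is [h2] instead
   of [h1]. *)
have [|||-> ->] // := exponents_inj (de := al) (de' := al') _ _ _ m0 m0' a6 b6.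
- by rewrite !mulrN -opprD addrC h2 oppr0.
- by rewrite addrC mulrN oppr_eq0.
- by rewrite addrC mulrN oppr_eq0.
Qed.

End Exponents.

Lemma F_qexp_fam (C : fieldType) (q : C) (hq : q != 0) t (p p' : C)
    (x x' : qtorus hq) i :
  F t (qexp_fam p p' x x' i) = qexp_fam p p' (F t x) (F t x') i.
Proof. by rewrite /qexp_fam rmorphM /= !linearZ /= !rmorphXn. Qed.

Definition add2 (A B : nat * nat) : nat * nat := ((A.1 + B.1)%N, (A.2 + B.2)%N).

Lemma sub2K A B : sub2 (add2 A B) B = A.
Proof. by case: A => a a'; rewrite /sub2 /= !addnK. Qed.

Lemma mem_split_range_add2 A B D : B \in split_range (add2 A B) (add2 B D).
Proof. by rewrite mem_split_range /= !leq_addl !leq_addr. Qed.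

Lemma addr_reorderL (V : zmodType) (x y z t k : V) :
  x + (y + z) + k + t = (x + y) + (t + z) + k.
Proof. by rewrite addrAC !addrA (addrAC _ z). Qed.

Lemma addr_reorderR (V : zmodType) (x y z k l : V) :
  k + z + (l + y) + x = (x + y) + z + (k + l).
Proof.
rewrite addrACA -[LHS]addrA [LHS]addrC; congr (_ + _).
by rewrite [LHS]addrC (addrC z y) addrA.
Qed.

Section ScaledFamily.
Context (C : fieldType) (q : C) (hq : q != 0) (al be de : int) (m : nat).
Context (c : C -> C).
Local Notation Q := (q ^ (- ((al + de) * be))).
Local Notation F := (@F C q hq).

(** The argument of the exponential in [g]. The function [c] stands for $\lambda\mapsto\lambda^k$;
    leaving it abstract allows the value 0, which switches a family off in part (i). *)
Definition scaled_gen t l :=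
  Q ^+ 'C(m, 2) * c l *: triple_gen hq al be de t ^+ m.

Definition scaled_wgen l :=
  Q ^+ 'C(m, 2) * c l *: wgen hq al be de ^+ m.

Lemma F_scaleX t d x n : F t (d *: x ^+ n) = d *: F t x ^+ n.
Proof. by rewrite linearZ /= rmorphXn. Qed.

Lemma F_scaled123 l :
  F t356 (F t246 (F t145 (scaled_gen t123 l))) = scaled_gen t123 l.
Proof. by rewrite /scaled_gen !F_scaleX F_gen123. Qed.

Lemma F_scaled145 k l : c (k * l) = c k * c l ->
  F t356 (F t246 (scaled_gen t145 (k * l))) =
  scaled_gen t123 k * scaled_gen t356 l.
Proof.
move=> ckl; rewrite /scaled_gen !F_scaleX F_gen145 ckl.
exact/scaleXM_qcomm/vu_qcomm.
Qed.

Lemma F_scaled246 l : F t356 (scaled_gen t246 l) = scaled_wgen l.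
Proof. by rewrite /scaled_gen !F_scaleX F_gen246. Qed.

Lemma F_scaled356' l :
  F t123 (F t145 (F t246 (scaled_gen t356 l))) = scaled_wgen l.
Proof. by rewrite /scaled_gen !F_scaleX F_gen356'. Qed.

Lemma F_scaled246' l : F t123 (F t145 (scaled_gen t246 l)) = scaled_gen t356 l.
Proof. by rewrite /scaled_gen !F_scaleX F_gen246'. Qed.

Lemma F_scaled145' k l : c (k * l) = c k * c l ->
  F t123 (scaled_gen t145 (k * l)) = scaled_wgen l * scaled_gen t123 k.
Proof.
move=> ckl; rewrite /scaled_gen !F_scaleX F_gen145' ckl (mulrC (c k)).
exact/scaleXM_qcomm/uw_qcomm.
Qed.

Lemma scaled_vu k l : scaled_gen t356 l * scaled_gen t123 k =
  Q ^+ (m ^ 2) *: (scaled_gen t123 k * scaled_gen t356 l).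
Proof. exact/scaleX_qcomm/vu_qcomm. Qed.

Lemma scaled_uw k l : scaled_gen t123 l * scaled_wgen k =
  Q ^+ (m ^ 2) *: (scaled_wgen k * scaled_gen t123 l).
Proof. exact/scaleX_qcomm/uw_qcomm. Qed.

Lemma scaled_wv k l : scaled_wgen l * scaled_gen t356 k =
  Q ^+ (m ^ 2) *: (scaled_gen t356 k * scaled_wgen l).
Proof. exact/scaleX_qcomm/wv_qcomm. Qed.

End ScaledFamily.

Lemma comm_scale_mono (C : fieldType) (q : C) (hq : q != 0) (c d : C)
    (M N : mon) :
  pairing M N = pairing N M ->
  GRing.comm (c *: mono hq M) (d *: mono hq N).
Proof.
move=> e; rewrite /GRing.comm (scale_mono_qcomm hq c d (z := 0)) ?addr0 //.
by rewrite expr0z scale1r.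
Qed.

(** * The tetrahedron equation *)

Section GeneralSolution.
Context (C : fieldType) (q : C) (hq : q != 0).
Context (al be de al' be' de' : int) (m m' : nat).
Hypotheses (h1 : al * be' + de' * be = 0) (h2 : al' * be + de * be' = 0).
Hypotheses (nz : (al + de) * be != 0) (nz' : (al' + de') * be' != 0).
Hypotheses (m0 : (0 < m)%N) (m0' : (0 < m')%N).
Local Notation Q := (q ^ (- ((al + de) * be))).
Local Notation Q' := (q ^ (- ((al' + de') * be'))).
Local Notation P := (Q ^+ (m ^ 2)).
Local Notation P' := (Q' ^+ (m' ^ 2)).
Hypothesis hP : forall n, (0 < n)%N -> P ^+ n != 1.
Hypothesis hP' : forall n, (0 < n)%N -> P' ^+ n != 1.
Context (c c' : C -> C).
Local Notation F := (@F C q hq).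

Let U := scaled_gen hq al be de m c.
Let W := scaled_wgen hq al be de m c.
Let U' := scaled_gen hq al' be' de' m' c'.
Let W' := scaled_wgen hq al' be' de' m' c'.

(** For each of the nine pairs, the two pairings agree by [h1], by [h2], or by both. *)
Lemma scaled_comm k l n k' l' n' x y :
  x \in [:: U t123 k; U t356 l; W n] ->
  y \in [:: U' t123 k'; U' t356 l'; W' n'] ->
  GRing.comm x y.
Proof.
rewrite !inE => /or3P[]/eqP-> /or3P[]/eqP->;
  apply: comm_scaleX; apply: comm_scale_mono; rewrite !pairingE.
all: lia.
Qed.

Lemma scaled_component lam mu nu (D E J : nat * nat) :
  \sum_(i <- split_range D E)
     qexp_fam P P' (U t123 lam) (U' t123 lam) (sub2 D i) *
     qexp_fam P P' (U t123 lam * U t356 mu) (U' t123 lam * U' t356 mu) i *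
     qexp_fam P P' (W nu) (W' nu) J *
     qexp_fam P P' (U t356 mu) (U' t356 mu) (sub2 E i) =
  \sum_(i <- split_range D J) qexp_fam P P' (W nu) (W' nu) (sub2 J i) *
     qexp_fam P P' (U t356 mu) (U' t356 mu) E *
     qexp_fam P P' (W nu * U t123 lam) (W' nu * U' t123 lam) i *
     qexp_fam P P' (U t123 lam) (U' t123 lam) (sub2 D i).
Proof.
have P0 : P != 0 by rewrite expf_neq0 // expfz_neq0.
have P0' : P' != 0 by rewrite expf_neq0 // expfz_neq0.
apply: (tetrahedron_component_fam hP P0 hP' P0').
- exact: scaled_vu.
- exact: scaled_uw.
- exact: scaled_wv.
- exact: scaled_vu.
- exact: scaled_uw.
- exact: scaled_wv.
- exact: scaled_comm.
Qed.

Lemma F_fam123 k i :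
  F t356 (F t246 (F t145
    (qexp_fam P P' (U t123 k) (U' t123 k) i))) =
  qexp_fam P P' (U t123 k) (U' t123 k) i.
Proof.
rewrite (F_qexp_fam t145) (F_qexp_fam t246) (F_qexp_fam t356).
apply: (congr2 (fun x x' => qexp_fam P P' x x' i)); exact: F_scaled123.
Qed.

Lemma F_fam145 k l i : c (k * l) = c k * c l -> c' (k * l) = c' k * c' l ->
  F t356 (F t246 (qexp_fam P P' (U t145 (k * l)) (U' t145 (k * l)) i)) =
  qexp_fam P P' (U t123 k * U t356 l) (U' t123 k * U' t356 l) i.
Proof.
move=> e e'; rewrite (F_qexp_fam t246) (F_qexp_fam t356).
apply: (congr2 (fun x x' => qexp_fam P P' x x' i)); exact: F_scaled145.
Qed.

Lemma F_fam246 k i :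
  F t356 (qexp_fam P P' (U t246 k) (U' t246 k) i) =
  qexp_fam P P' (W k) (W' k) i.
Proof.
rewrite (F_qexp_fam t356).
apply: (congr2 (fun x x' => qexp_fam P P' x x' i)); exact: F_scaled246.
Qed.

Lemma F_fam356' k i :
  F t123 (F t145 (F t246
    (qexp_fam P P' (U t356 k) (U' t356 k) i))) =
  qexp_fam P P' (W k) (W' k) i.
Proof.
rewrite (F_qexp_fam t246) (F_qexp_fam t145) (F_qexp_fam t123).
apply: (congr2 (fun x x' => qexp_fam P P' x x' i)); exact: F_scaled356'.
Qed.

Lemma F_fam246' k i :
  F t123 (F t145 (qexp_fam P P' (U t246 k) (U' t246 k) i)) =
  qexp_fam P P' (U t356 k) (U' t356 k) i.
Proof.
rewrite (F_qexp_fam t145) (F_qexp_fam t123).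
apply: (congr2 (fun x x' => qexp_fam P P' x x' i)); exact: F_scaled246'.
Qed.

Lemma F_fam145' k l i : c (k * l) = c k * c l -> c' (k * l) = c' k * c' l ->
  F t123 (qexp_fam P P' (U t145 (k * l)) (U' t145 (k * l)) i) =
  qexp_fam P P' (W l * U t123 k) (W' l * U' t123 k) i.
Proof.
move=> e e'; rewrite (F_qexp_fam t123).
apply: (congr2 (fun x x' => qexp_fam P P' x x' i)); exact: F_scaled145'.
Qed.

Context (R : triple -> C -> series hq).
Hypothesis R_rep : forall t l, represents (R t l) (Ggen hq t)
  (triple_fam al be de al' be' de' m m' t)
  (qexp_fam P P' (U t l) (U' t l)).

(** Both sides are computed by [sprod4] over the same total degrees and agree there by
    [scaled_component]. Multiplicativity of [c] and [c'] is required for the factor 145, whose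
    parameter is a product. *)
Lemma tetrahedron_represents (lam mu nu : C) :
  c (lam * mu) = c lam * c mu -> c' (lam * mu) = c' lam * c' mu ->
  c (lam * nu) = c lam * c nu -> c' (lam * nu) = c' lam * c' nu ->
  tetrahedron R lam mu nu.
Proof.
move=> cm cm' cn cn'.
have Einj := tetra_fam_inj h1 h2 nz nz' m0 m0'.
have Minj := triple_fam_inj h1 nz nz' m0 m0'.
pose e := triple_fam al be de al' be' de' m m'.
pose w := wfam al be de al' be' de' m m'.
pose I : eqType := ((nat * nat) * (nat * nat) * (nat * nat))%type.
(* A, B, K are the total exponents of u, v, w; i is the exponent of uv on the
   left and of wu on the right. *)
pose covL (j : I) : seq quad :=
  [seq (sub2 j.1.1 i, i, j.2, sub2 j.1.2 i) | i <- split_range j.1.1 j.1.2].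
pose covR (j : I) : seq quad :=
  [seq (sub2 j.2 i, j.1.2, i, sub2 j.1.1 i) | i <- split_range j.1.1 j.2].
have [||||||S [SE Sv Ss]] := @sprod4 _ _ hq t123 t145 t246 t356 _ _ _ _ _ _ _ _
  (e t123) (fun i => e t123 i + e t356 i) w _ _ _ _ I _ covL
  (R_rep t123 lam) (R_rep t145 (lam * mu)) (R_rep t246 nu) (R_rep t356 mu)
  (Minj _) (Minj _) (Minj _) (Minj _) _ _ _ Einj.
- by move=> i; rewrite !F_mono !Fmon_fam !FmonMn !Fmon_123.
- by move=> i; rewrite !F_mono !Fmon_fam !FmonMn !Fmon_145 !mulrnDl mon_famD.
- by move=> i; rewrite !F_mono !Fmon_fam !FmonMn !Fmon_246.
- move=> j; rewrite map_inj_uniq ?split_range_uniq // => i i'.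
  exact: (congr1 (fun x : quad => x.1.1.2)).
(* The degree [i2] in [u * v] counts once for [u] and once for [v]. *)
- move=> [[[i1 i2] i3] i4]; exists (add2 i1 i2, add2 i2 i4, i3).
  apply/mapP; exists i2; first exact: mem_split_range_add2.
  rewrite /= sub2K; congr (_, _, _, _).
  by case: i2 i4 => [a a'] [b b']; rewrite /sub2 /= !addKn.
- move=> [[A B] K] _ /mapP[i + ->]; rewrite mem_split_range.
  move=> /and4P[a1 b1 a2 b2].
  rewrite /tetra_fam /= -/(e t123) -/(e t356) -/w.
  have <- : e t123 (sub2 A i) + e t123 i = e t123 A by exact: mon_fam_sub.
  have <- : e t356 (sub2 B i) + e t356 i = e t356 B by exact: mon_fam_sub.
  exact: addr_reorderL.
have [||||||S' [SE' Sv' Ss']] := @sprod4 _ _ hq t356 t246 t145 t123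
  _ _ _ _ _ _ _ _ w (e t356) (fun i => w i + e t123 i) _ _ _ _ I _ covR
  (R_rep t356 nu) (R_rep t246 mu) (R_rep t145 (lam * nu)) (R_rep t123 lam)
  (Minj _) (Minj _) (Minj _) (Minj _) _ _ _ Einj.
- by move=> i; rewrite !F_mono !Fmon_fam !FmonMn !Fmon_356'.
- by move=> i; rewrite !F_mono !Fmon_fam !FmonMn !Fmon_246'.
- by move=> i; rewrite !F_mono !Fmon_fam !FmonMn !Fmon_145' !mulrnDl mon_famD.
- move=> j; rewrite map_inj_uniq ?split_range_uniq // => i i'.
  exact: (congr1 (fun x : quad => x.1.2)).
(* On the right the degree [i3] in [w * u] counts for [u] and for [w]. *)
- move=> [[[i1 i2] i3] i4]; exists (add2 i4 i3, i2, add2 i1 i3).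
  apply/mapP; exists i3; last by rewrite /= !sub2K.
  by rewrite mem_split_range /= !leq_addl.
- move=> [[A B] K] _ /mapP[i + ->]; rewrite mem_split_range.
  move=> /and4P[a1 b1 a2 b2].
  rewrite /tetra_fam /= -/(e t123) -/(e t356) -/w.
  have <- : e t123 (sub2 A i) + e t123 i = e t123 A by exact: mon_fam_sub.
  have <- : w (sub2 K i) + w i = w K by exact: mon_fam_sub.
  exact: addr_reorderR.
exists S; split=> //; rewrite SE'; congr Some; apply: funext => x.
pose g := (Ggen hq t123 * (Ggen hq t145 * (Ggen hq t246 * Ggen hq t356)))%g.
pose E := tetra_fam al be de al' be' de' m m'.
have SS' j : S' (g, E j) = S (g, E j).
  suff e' : forall (k l : C) M, k *: mono hq M = l *: mono hq M -> k = l.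
    apply: (e' _ _ (E j)).
    rewrite Sv /g tetrahedron_G Sv' /covL /covR !big_map /=.
    transitivity (\sum_(i <- split_range j.1.1 j.2)
      qexp_fam P P' (W nu) (W' nu) (sub2 j.2 i) *
      qexp_fam P P' (U t356 mu) (U' t356 mu) j.1.2 *
      qexp_fam P P' (W nu * U t123 lam) (W' nu * U' t123 lam) i *
      qexp_fam P P' (U t123 lam) (U' t123 lam) (sub2 j.1.1 i)).
      by apply: eq_bigr => i _; congr (_ * _ * _ * _);
        [exact: F_fam356' | exact: F_fam246' | exact: F_fam145'].
    rewrite -scaled_component; apply: eq_bigr => i _.
    by congr (_ * _ * _ * _);
      [rewrite F_fam123 | rewrite F_fam145 | rewrite F_fam246].
  move=> k l M /(congr1 (mcoeff M)).
  by rewrite !mcoeff_mono eqxx.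
(* Off the elements [(g, E j)] both series vanish. *)
have [Sx|/Ss[j ->]] := eqVneq (S x) 0; last by rewrite SS'.
have [->|] := eqVneq (S' x) 0; first by rewrite Sx.
by move=> /Ss'[j ->]; rewrite -tetrahedron_G SS'.
Qed.

End GeneralSolution.

(** * Specialization to complex [q] and the two parts of the theorem *)

Lemma expfz_neq1 (R : realType) (q : R[i]) (z : int) :
  `|q| != 1 -> z != 0 -> q ^ z != 1.
Proof.
have expn_neq1 (n : nat) : `|q| != 1 -> q ^+ n.+1 != 1.
  move=> q1; apply: contraNneq q1 => /(congr1 (fun x => `|x|)).
  by rewrite normrX normr1 => /eqP; rewrite pexpr_eq1.
case: z => [[|n]|n] //= q1 _; first exact: expn_neq1.
by rewrite NegzE -exprnN invr_eq1 expn_neq1.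
Qed.

(** Guarantees that the base $Q^{m^2}$ is not a root of unity, so the denominators of the
    exponential are nonzero. *)
Lemma expfz_exp_neq1 (R : realType) (q : R[i]) (z : int) (m : nat) :
  `|q| != 1 -> z != 0 -> (0 < m)%N ->
  forall n, (0 < n)%N -> ((q ^ (- z)) ^+ (m ^ 2)) ^+ n != 1.
Proof.
move=> q1 z0 m0 n n0; rewrite -exprM.
have -> : (q ^ (- z)) ^+ (m ^ 2 * n) = q ^ (- z * (m ^ 2 * n)%N).
  by rewrite exprnP exprz_exp.
apply: expfz_neq1 => //; rewrite mulf_neq0 ?oppr_eq0 //.
by rewrite eqz_nat -lt0n muln_gt0 expn_gt0 m0.
Qed.

(** The powers are told apart by the exponent of $b_i$, a multiple of the nonzero number
    [be *+ m]. *)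
Lemma qexp_triple_represents (C : fieldType) (q : C) (hq : q != 0)
    (al be de : int) (m : nat) (c : C -> C) t l p :
  (al + de) * be != 0 -> (0 < m)%N ->
  represents (qexp p (scaled_gen hq al be de m c t l)) 1%g
    (GRing.natmul (triple_mon t al be de *+ m))
    (fun n => qexp_coef p n *: scaled_gen hq al be de m c t l ^+ n).
Proof.
move=> nz m0; rewrite /scaled_gen /triple_gen.
have [k ->] := scale_monoX hq (q ^ (- (al * be))) (triple_mon t al be de) m.
rewrite scalerA; apply: qexp_represents => n n' e.
have := congr1 (fun M : mon => M.2 (ti t)) e.
rewrite !monMn2 ffunE eqxx -!mulrnA => /eqP.
have be0 : be != 0 by move: nz; rewrite mulf_eq0 negb_or => /andP[].
rewrite -subr_eq0 -!(mulr_natr be) -mulrBr mulf_eq0 (negPf be0) /= subr_eq0.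
by rewrite eqr_nat eqn_mul2l eqn0Ngt m0 /= => /eqP.
Qed.

Theorem theorem2 (R : realType) (q : R[i]) (hq : q != 0) (hq1 : `|q| != 1) :
  (forall (alpha1 alpha2 alpha3 beta1 beta2 beta3 : int) (m : nat) (k : int)
      (lam mu nu : R[i]),
    alpha1 + alpha2 = 0 -> beta2 = 0 -> beta1 + beta3 = 0 ->
    (alpha1 + alpha3) * beta1 != 0 ->
    (0 < m)%N ->
    (k < 0 -> [/\ lam != 0, mu != 0 & nu != 0]) ->
    let Q := q ^ (- ((alpha1 + alpha3) * beta1)) in
    let g (l : R[i]) (t : qtorus hq) :=
      qexp (Q ^+ (m ^ 2)) ((Q ^+ (m * m.-1)./2 * l ^ k) *: t ^+ m) in
    tetrahedron
      (fun (t : triple) (l : R[i]) =>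
        let: (a1, a2, a3) := (agen hq (ti t), agen hq (tj t), agen hq (tk t)) in
        let: (b1, b2, b3) := (bgen hq (ti t), bgen hq (tj t), bgen hq (tk t)) in
        sprod [:: sgroup (Ggen hq t);
          g l (q ^ (- (alpha1 * beta1)) *:
            (a1 ^ alpha1 * a2 ^ alpha2 * a3 ^ alpha3 *
             b1 ^ beta1 * b2 ^ beta2 * b3 ^ beta3))])
      lam mu nu)
  /\
  (forall (alpha beta delta alpha' beta' delta' : int) (m m' : nat) (k l : int)
      (lam mu nu : R[i]),
    alpha * beta' + delta' * beta = 0 -> alpha' * beta + delta * beta' = 0 ->
    (alpha + delta) * beta != 0 -> (alpha' + delta') * beta' != 0 ->
    (0 < m)%N -> (0 < m')%N ->
    (k < 0 \/ l < 0 -> [/\ lam != 0, mu != 0 & nu != 0]) ->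
    let Q := q ^ (- ((alpha + delta) * beta)) in
    let Q' := q ^ (- ((alpha' + delta') * beta')) in
    let g (c : R[i]) (t : qtorus hq) :=
      qexp (Q ^+ (m ^ 2)) ((Q ^+ (m * m.-1)./2 * c ^ k) *: t ^+ m) in
    let f (c : R[i]) (t : qtorus hq) :=
      qexp (Q' ^+ (m' ^ 2)) ((Q' ^+ (m' * m'.-1)./2 * c ^ l) *: t ^+ m') in
    tetrahedron
      (fun (t : triple) (c : R[i]) =>
        let: (a1, a2, a3) := (agen hq (ti t), agen hq (tj t), agen hq (tk t)) in
        let: (b1, b3) := (bgen hq (ti t), bgen hq (tk t)) in
        sprod [:: sgroup (Ggen hq t);
          g c (q ^ (- (alpha * beta)) *:
            (a1 ^ alpha * a2 ^ (- alpha) * a3 ^ delta *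
             b1 ^ beta * b3 ^ (- beta)));
          f c (q ^ (- (alpha' * beta')) *:
            (a1 ^ alpha' * a2 ^ (- alpha') * a3 ^ delta' *
             b1 ^ beta' * b3 ^ (- beta')))])
      lam mu nu).

Proof.
split.
- move=> al al2 de be be2 be3 m k lam mu nu.
  rewrite addrC => /eqP; rewrite addr_eq0 => /eqP -> ->.
  rewrite addrC => /eqP; rewrite addr_eq0 => /eqP -> nz m0 _ Q g.
  (* The hatted parameters are [- de], [be], [- al] with [m' = 1]; then [h1] and [h2] are identities
     and [nz'] is [nz] up to sign. *)
  have h1 : al * be + - al * be = 0 by ring.
  have h2 : - de * be + de * be = 0 by ring.
  have nz' : (- de + - al) * be != 0.
    by rewrite -opprD addrC mulNr oppr_eq0.
  apply: (tetrahedron_represents (c := fun l => l ^ k) (c' := fun=> 0)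
    h1 h2 nz nz' m0 (ltnSn 0) (expfz_exp_neq1 hq1 nz m0)
    (expfz_exp_neq1 hq1 nz' (ltnSn 0))); last first.
  + by rewrite mulr0.
  + exact: expfzMl.
  + by rewrite mulr0.
  + exact: expfzMl.
  move=> t l; rewrite /g -bin2.
  rewrite expr0z mulr1 triple_mono.
  (* With [c'] equal to 0 the hatted generator is 0, the situation of [qexp1_represents]. *)
  rewrite [X in qexp_fam _ _ _ X]/scaled_gen mulr0 scale0r.
  apply: qexp1_represents; last exact: qexp_triple_represents.
  exact: triple_fam_inj h1 nz nz' m0 (ltnSn 0) t.
move=> al be de al' be' de' m m' k l lam mu nu h1 h2 nz nz' m0 m0' _ Q Q' g f.
apply: (tetrahedron_represents (c := fun x => x ^ k) (c' := fun x => x ^ l)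
    h1 h2 nz nz' m0 m0' (expfz_exp_neq1 hq1 nz m0)
    (expfz_exp_neq1 hq1 nz' m0')); last first.
- exact: expfzMl.
- exact: expfzMl.
- exact: expfzMl.
- exact: expfzMl.
move=> t x; rewrite /g /f -!bin2 !triple_mono.
apply: qexp2_represents; try exact: qexp_triple_represents.
exact: triple_fam_inj h1 nz nz' m0 m0' t.
Qed.
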